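(* Let $(A,G,\alpha)$ and $(B,G,\beta)$ be $C^*$-dynamical systems. Every non-degenerate completely positive $G$-equivariant map $\phi:A\to M(B)$ determines and is determined by a $G$-equivariant coupling of the form $$(((A,G,\alpha),(B,G,\beta),((B,\phi),\beta)),((A,G,\alpha),A,\alpha)),$$ where $A$ and $B$ are viewed as Hilbert modules over themselves; i.e. this data is a $G$-equivariant coupling if and only if $\phi$ is a non-degenerate completely positive $G$-equivariant map. Furthermore, if $(F_\phi,\pi_\phi,V_\phi,W)$ is the (unitarily unique) quadruple obtained from applying the equivariant KSGNS construction to the non-degenerate positive equivariant $C^*$-correspondence $((B,\phi),\beta)$, then (1) the relational joint space is canonically unitarily isomorphic to $F_\phi$; (2) the relational joint system is canonically isomorphic to $\mathcal{L}(F_\phi)$; (3) the reference frame system is canonically isomorphic to $\mathcal{L}(F_\phi)^{\mathrm{Ad}(W)}$; (4) a relativization map for the equivariant coupling determines and is determined by (via the canonical isomorphism in (2)) a completely positive map $\pounds:M(A)\to\mathcal{L}(F_\phi)^{\mathrm{Ad}(W)}$ which is strictly continuous on the unit ball in $M(A)$ and satisfies $\pounds(T)=\tilde\pi_\phi(T)$ for all $T\in M(A)^{\mathrm{Ad}(\alpha)}$, where $\tilde\pi_\phi$ is the unique unital $*$-algebra homomorphism which extends $\pi_\phi$ to $M(A)$.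
   Context: Hilbert modules are right modules; $\mathcal{L}(E)$ denotes adjointable operators, $\mathcal{B}(E)$ bounded $\mathbb{C}$-linear operators, $M(A)=\mathcal{L}(A)$ the multiplier algebra. The strict topology on $\mathcal{L}(E)$ is generated by $T\mapsto\|Tx\|$, $T\mapsto\|T^*x\|$, $x\in E$. A completely positive map $\phi:A\to\mathcal{L}(E)$ is non-degenerate if there is an approximate unit $(e_\lambda)$ of $A$ with $\phi(e_\lambda)\to 1_E$ strictly. A $*$-homomorphism $\rho:A\to\mathcal{L}(E)$ is non-degenerate if the span of $\rho(A)E$ is dense in $E$. A $C^*$-dynamical system $(A,G,\alpha)$ is a $C^*$-algebra $A$, a group $G$, and a homomorphism $\alpha:G\to\mathrm{Aut}_{*\text{-alg}}(A)$. Each $\beta_g$ extends uniquely to an automorphism $\tilde\beta_g$ of $M(B)$; $\phi:A\to M(B)$ is $G$-equivariant if $\phi(\alpha_g(a))=\tilde\beta_g(\phi(a))$. For $\beta\in\mathrm{Aut}(B)$, a map $T:E_1\to E_2$ of Hilbert $B$-modules is $\beta$-adjointable if there is $T^*:E_2\to E_1$ with $\langle Tx,y\rangle=\beta(\langle x,T^*y\rangle)$; it is a $\beta$-adjointable unitary if also $TT^*=1$, $T^*T=1$. A Hilbert module dynamical system $((B,G,\beta),E_B,U)$: $E_B$ a Hilbert $B$-module and $U:G\to\mathcal{B}(E_B)$ a group homomorphism with each $U_g$ a $\beta_g$-adjointable unitary. An equivariant $C^*$-correspondence (resp. non-degenerate positive equivariant $C^*$-correspondence) $((E_B,\rho),U)$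 from $(A,G,\alpha)$ to $(B,G,\beta)$: a Hilbert $B$-module $E_B$, a non-degenerate $*$-homomorphism (resp. non-degenerate completely positive map) $\rho:A\to\mathcal{L}(E_B)$, and $U:G\to\mathcal{B}(E_B)$ a group homomorphism with each $U_g$ a $\beta_g$-adjointable unitary and $U_g\rho(a)=\rho(\alpha_g(a))U_g$. Equivariant KSGNS construction: for a non-degenerate positive equivariant $C^*$-correspondence $((E,\phi),U)$ there is a quadruple $(F_\phi,\pi_\phi,V_\phi,\tilde U)$, unique up to an intertwining $B$-linear unitary, with $((F_\phi,\pi_\phi),\tilde U)$ an equivariant $C^*$-correspondence, $V_\phi:E\to F_\phi$ adjointable $B$-linear, span of $\pi_\phi(A)V_\phi E$ dense in $F_\phi$, $\phi(a)=V_\phi^*\pi_\phi(a)V_\phi$, and $V_\phi U_g=\tilde U_gV_\phi$. A $G$-equivariant coupling for a Hilbert $A$-module $E_A$ is data $(((A,G,\alpha),(B,G,\beta),((E_B,\phi),W_0)),((A,G,\alpha),E_A,U))$ with $(A,G,\alpha),(B,G,\beta)$ $C^*$-dynamical systems, $((E_B,\phi),W_0)$ a non-degenerate positive equivariant $C^*$-correspondence from $(A,G,\alpha)$ to $(B,G,\beta)$, and $((A,G,\alpha),E_A,U)$ a Hilbert module dynamical system. With $(F_\phi,\pi_\phi,V_\phi,\tilde W)$ the equivariant KSGNS quadruple of $((E_B,\phi),W_0)$: the relational joint space is the interior tensor product $E_A\otimes_{\pi_\phi}F_\phi$ (with $G$-action $U\otimes_{\pi_\phi}\tilde W$ determined by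 $x\otimes y\mapsto U_gx\otimes\tilde W_gy$), the relational joint system is $\mathcal{L}(E_A\otimes_{\pi_\phi}F_\phi)$, and the reference frame system is its fixed-point algebra $\mathcal{L}(E_A\otimes_{\pi_\phi}F_\phi)^G$ under $\mathrm{Ad}(U\otimes_{\pi_\phi}\tilde W)$. A relativization map is a map $\pounds:\mathcal{L}(E_A)\to\mathcal{L}(E_A\otimes_{\pi_\phi}F_\phi)^G$ that is completely positive, strictly continuous on the unit ball, and satisfies $\pounds(T)=T\otimes_{\pi_\phi}I$ for all $T\in\mathcal{L}(E_A)^G$ (fixed points of $\mathrm{Ad}(U)$). *)

(* Defs.v *)
From HB Require Import structures.
From mathcomp Require Import all_boot all_order all_algebra complex.
From mathcomp Require Import all_classical all_reals all_analysis.

Set Implicit Arguments.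
Unset Strict Implicit.
Unset Printing Implicit Defensive.
Import Order.TTheory GRing.Theory Num.Theory.
Import numFieldNormedType.Exports.
Local Open Scope classical_set_scope.
Local Open Scope ring_scope.
Local Open Scope complex_scope.

(* Complex *-algebras, not necessarily unital: MathComp's own algebra           *)
(* structures all carry a unit.                                                 *)

HB.mixin Record isStarAlgebra (R : realType) A of GRing.Lmodule R[i] A := {
  amul : A -> A -> A;
  astar : A -> A;
  amulA : associative amul;
  amulDl : left_distributive amul +%R;
  amulDr : right_distributive amul +%R;
  amulZl : forall (k : R[i]) a b, amul (k *: a) b = k *: amul a b;
  amulZr : forall (k : R[i]) a b, amul a (k *: b) = k *: amul a b;
  astarK : involutive astar;
  astarD : {morph astar : a b / a + b};
  astarZ : forall (k : R[i]) a, astar (k *: a) = Num.conj k *: astar a;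
  astarM : forall a b, astar (amul a b) = amul (astar b) (astar a)
}.

#[short(type="starAlgType")]
HB.structure Definition StarAlgebra (R : realType) :=
  {A of GRing.Lmodule R[i] A & isStarAlgebra R A}.

Notation "a ** b" := (amul a b) (at level 40, left associativity) : ring_scope.
Notation "a ^†" := (astar a) (at level 1, left associativity, format "a ^†") :
  ring_scope.

HB.mixin Record isCStarAlgebra (R : realType) A
    of CompleteNormedModule R[i] A & StarAlgebra R A := {
  norm_amul_le : forall a b : A, `|a ** b| <= `|a| * `|b|;
  cstar_identity : forall a : A, `|a^† ** a| = `|a| ^+ 2
}.

#[short(type="cstarAlgType")]
HB.structure Definition CStarAlgebra (R : realType) :=
  {A of CompleteNormedModule R[i] A & StarAlgebra R A & isCStarAlgebra R A}.

Section StarAlgebras.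
Context {R : realType}.
Implicit Types A B : starAlgType R.

(* In a C*-algebra, and in matrices over one, positive elements are exactly the *)
(* elements of the form c^* c; (c^* c)_ij = \sum_k c_ki^* c_kj.                 *)
Definition positive A (a : A) : Prop := exists c : A, a = c^† ** c.

Definition positive_mx A n (M : 'M[A]_n) : Prop :=
  exists C : 'M[A]_n, forall i j, M i j = \sum_(k < n) (C k i)^† ** C k j.

Definition completely_positive A B (f : A -> B) : Prop :=
  linear f /\
  forall n (M : 'M[A]_n), positive_mx M -> positive_mx (map_mx f M).

Definition star_hom A B (f : A -> B) : Prop :=
  [/\ linear f, {morph f : a b / a ** b} & {morph f : a / a^†}].

Definition star_iso A B (f : A -> B) : Prop := star_hom f /\ bijective f.

End StarAlgebras.

(* Right Hilbert modules, with inner product linear in the second variable.     *)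
HB.mixin Record isHilbertModule (R : realType) (B : cstarAlgType R) E
    of CompleteNormedModule R[i] E := {
  ract : E -> B -> E;
  inner : E -> E -> B;
  ractDl : forall x y b, ract (x + y) b = ract x b + ract y b;
  ractDr : forall x b c, ract x (b + c) = ract x b + ract x c;
  ractZl : forall (k : R[i]) x b, ract (k *: x) b = k *: ract x b;
  ractZr : forall (k : R[i]) x b, ract x (k *: b) = k *: ract x b;
  ractA : forall x b c, ract x (b ** c) = ract (ract x b) c;
  innerDr : forall x y z, inner x (y + z) = inner x y + inner x z;
  innerZr : forall (k : R[i]) x y, inner x (k *: y) = k *: inner x y;
  inner_ract : forall x y b, inner x (ract y b) = inner x y ** b;
  inner_star : forall x y, (inner x y)^† = inner y x;
  inner_ge0 : forall x, positive (inner x x);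
  inner_eq0 : forall x, inner x x = 0 -> x = 0;
  norm_inner : forall x, `|x| ^+ 2 = `|inner x x|
}.

#[short(type="hilbertModType")]
HB.structure Definition HilbertModule (R : realType) (B : cstarAlgType R) :=
  {E of CompleteNormedModule R[i] E & isHilbertModule R B E}.

Arguments ract {R B s} x b.
Arguments inner {R B s} x y.

Section HilbertModuleTheory.
Context {R : realType} {B : cstarAlgType R} {E : hilbertModType B}.
Implicit Types (x y z : E) (b : B).

Lemma innerDl x y z : inner (x + y) z = inner x z + inner y z.
Proof. by rewrite -inner_star innerDr astarD !inner_star. Qed.

Lemma innerZl (k : R[i]) x y : inner (k *: x) y = Num.conj k *: inner x y.
Proof. by rewrite -inner_star innerZr astarZ !inner_star. Qed.

Lemma inner0r x : inner x (0 : E) = 0.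
Proof. by rewrite -(scale0r (0 : E)) innerZr scale0r. Qed.

Lemma inner0l x : inner (0 : E) x = 0.
Proof. by rewrite -(scale0r (0 : E)) innerZl conjC0 scale0r. Qed.

Lemma inner_inj x y : (forall z, inner z x = inner z y) -> x = y.
Proof.
move=> h; apply/eqP; rewrite -subr_eq0; apply/eqP/(@inner_eq0 R B).
by rewrite innerDr h -innerDr subrr inner0r.
Qed.

End HilbertModuleTheory.

(* The C*-algebra A as a Hilbert module over itself, with <a, b> = a^* b.       *)
Definition selfmod (R : realType) (A : cstarAlgType R) : Type := A.

Section SelfModule.
Context {R : realType} (A : cstarAlgType R).

HB.instance Definition _ := CompleteNormedModule.on (selfmod A).

Implicit Types (x y z : selfmod A) (b c : A) (k : R[i]).

Definition self_ract x b : selfmod A := (x : A) ** b.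
Definition self_inner x y : A := (x : A)^† ** (y : A).

Let self_ractDl x y b : self_ract (x + y) b = self_ract x b + self_ract y b.
Proof. exact: amulDl. Qed.
Let self_ractDr x b c : self_ract x (b + c) = self_ract x b + self_ract x c.
Proof. exact: amulDr. Qed.
Let self_ractZl k x b : self_ract (k *: x) b = k *: self_ract x b.
Proof. exact: amulZl. Qed.
Let self_ractZr k x b : self_ract x (k *: b) = k *: self_ract x b.
Proof. exact: amulZr. Qed.
Let self_ractA x b c : self_ract x (b ** c) = self_ract (self_ract x b) c.
Proof. exact: amulA. Qed.
Let self_innerDr x y z : self_inner x (y + z) = self_inner x y + self_inner x z.
Proof. exact: amulDr. Qed.
Let self_innerZr k x y : self_inner x (k *: y) = k *: self_inner x y.
Proof. exact: amulZr. Qed.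
Let self_inner_ract x y b : self_inner x (self_ract y b) = self_inner x y ** b.
Proof. exact: amulA. Qed.
Let self_inner_star x y : (self_inner x y)^† = self_inner y x.
Proof. by rewrite /self_inner astarM astarK. Qed.
Let self_inner_ge0 x : positive (self_inner x x).
Proof. by exists x. Qed.
Let self_norm x : `|x| ^+ 2 = `|self_inner x x|.
Proof. by rewrite /self_inner cstar_identity. Qed.
Let self_inner_eq0 x : self_inner x x = 0 -> x = 0.
Proof.
move=> h; apply/eqP; rewrite -normr_eq0 -sqrf_eq0.
by rewrite self_norm h normr0.
Qed.

HB.instance Definition _ := isHilbertModule.Build R A (selfmod A)
  self_ractDl self_ractDr self_ractZl self_ractZr self_ractA self_innerDr
  self_innerZr self_inner_ract self_inner_star self_inner_ge0 self_inner_eq0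
  self_norm.

End SelfModule.

(* Adjointable operators. The adjoint is carried along, but it is determined by *)
(* the operator (lemma adjP), so equality is equality of functions.             *)
Record adjointable (R : realType) (B : cstarAlgType R)
    (E F : hilbertModType B) := Adjointable {
  adj_fun :> E -> F;
  adj_adj : F -> E;
  adj_prop : forall x y, inner (adj_fun x) y = inner x (adj_adj y)
}.

Notation "''L' ( E , F )" := (adjointable E F) (format "''L' ( E ,  F )") :
  type_scope.
Notation "''L' ( E )" := (adjointable E E) (format "''L' ( E )") : type_scope.

Section Adjointable.
Context {R : realType} {B : cstarAlgType R}.
Implicit Types E F H : hilbertModType B.

Lemma adj_prop' E F (T : 'L(E, F)) x y :
  inner (adj_adj T x) y = inner x (T y).
Proof. by rewrite -inner_star -adj_prop inner_star. Qed.

Lemma adjP E F (S T : 'L(E, F)) : (forall x, S x = T x) -> S = T.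
Proof.
move=> h; have hf : adj_fun S = adj_fun T by apply/funext.
have ha : adj_adj S = adj_adj T.
  apply/funext => y; apply: inner_inj => z.
  by rewrite -!adj_prop h.
case: S T hf ha {h} => [f g p] [f' g' p'] /= e e'.
by subst f' g'; congr Adjointable; exact: Prop_irrelevance.
Qed.

Lemma adj_linear E F (T : 'L(E, F)) : linear T.
Proof.
move=> k x y; apply: inner_inj => z.
by rewrite innerDr innerZr -!adj_prop' innerDr innerZr.
Qed.

Lemma adj_ract E F (T : 'L(E, F)) x b : T (ract x b) = ract (T x) b.
Proof.
by apply: inner_inj => z; rewrite inner_ract -!(adj_prop' T) inner_ract.
Qed.

Definition adjoint E F (T : 'L(E, F)) : 'L(F, E) :=
  Adjointable (adj_prop' T).

Fact adj_id_subproof E (x y : E) : inner (id x) y = inner x (id y).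
Proof. by []. Qed.
Definition adj_id E : 'L(E) := Adjointable (@adj_id_subproof E).

Fact adj_comp_subproof E F H (S : 'L(F, H)) (T : 'L(E, F)) x y :
  inner ((S \o T) x) y = inner x ((adj_adj T \o adj_adj S) y).
Proof. by rewrite /= !adj_prop. Qed.
Definition adj_comp E F H (S : 'L(F, H)) (T : 'L(E, F)) : 'L(E, H) :=
  Adjointable (adj_comp_subproof S T).

Section Lmodule.
Variable E : hilbertModType B.

HB.instance Definition _ := gen_eqMixin 'L(E).
HB.instance Definition _ := gen_choiceMixin 'L(E).

Fact adj_zero_subproof (x y : E) : inner (0 : E) y = inner x (0 : E).
Proof. by rewrite inner0l inner0r. Qed.
Definition adj_zero : 'L(E) := Adjointable adj_zero_subproof.

Fact adj_add_subproof (S T : 'L(E)) x y :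
  inner (S x + T x) y = inner x (adj_adj S y + adj_adj T y).
Proof. by rewrite innerDl innerDr !adj_prop. Qed.
Definition adj_add (S T : 'L(E)) : 'L(E) := Adjointable (adj_add_subproof S T).

Fact adj_scale_subproof (k : R[i]) (T : 'L(E)) x y :
  inner (k *: T x) y = inner x (Num.conj k *: adj_adj T y).
Proof. by rewrite innerZl innerZr adj_prop. Qed.
Definition adj_scale (k : R[i]) (T : 'L(E)) : 'L(E) :=
  Adjointable (adj_scale_subproof k T).

Fact adj_addA : associative adj_add.
Proof. by move=> S T U; apply: adjP => x; exact: addrA. Qed.
Fact adj_addC : commutative adj_add.
Proof. by move=> S T; apply: adjP => x; exact: addrC. Qed.
Fact adj_add0 : left_id adj_zero adj_add.
Proof. by move=> S; apply: adjP => x; exact: add0r. Qed.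
Fact adj_addN : left_inverse adj_zero (adj_scale (-1)) adj_add.
Proof. by move=> S; apply: adjP => x /=; rewrite scaleN1r addNr. Qed.

HB.instance Definition _ :=
  GRing.isZmodule.Build 'L(E) adj_addA adj_addC adj_add0 adj_addN.

Fact adj_scaleA (k l : R[i]) (T : 'L(E)) :
  adj_scale k (adj_scale l T) = adj_scale (k * l) T.
Proof. by apply: adjP => x; exact: scalerA. Qed.
Fact adj_scale1 : left_id 1 adj_scale.
Proof. by move=> T; apply: adjP => x; exact: scale1r. Qed.
Fact adj_scaleDr : right_distributive adj_scale +%R.
Proof. by move=> k S T; apply: adjP => x; exact: scalerDr. Qed.
Fact adj_scaleDl (T : 'L(E)) :
  {morph adj_scale^~ T : k l / k + l >-> k + l}.
Proof. by move=> k l; apply: adjP => x; exact: scalerDl. Qed.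

HB.instance Definition _ := GRing.Zmodule_isLmodule.Build R[i] 'L(E)
  adj_scaleA adj_scale1 adj_scaleDr adj_scaleDl.

Let mul (S T : 'L(E)) : 'L(E) := adj_comp S T.
Let star (T : 'L(E)) : 'L(E) := adjoint T.

Let mulA : associative mul.
Proof. by move=> S T U; apply: adjP. Qed.
Let mulDl : left_distributive mul +%R.
Proof. by move=> S T U; apply: adjP. Qed.
Let mulDr : right_distributive mul +%R.
Proof.
move=> S T U; apply: adjP => x /=; apply: inner_inj => z.
by rewrite innerDr -!(adj_prop' S) innerDr.
Qed.
Let mulZl (k : R[i]) S T : mul (k *: S) T = k *: mul S T.
Proof. exact: adjP. Qed.
Let mulZr (k : R[i]) S T : mul S (k *: T) = k *: mul S T.
Proof.
apply: adjP => x /=; apply: inner_inj => z.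
by rewrite innerZr -!(adj_prop' S) innerZr.
Qed.
Let starK : involutive star.
Proof. by move=> T; apply: adjP. Qed.
Let starD : {morph star : S T / S + T}.
Proof. by move=> S T; apply: adjP. Qed.
Let starZ (k : R[i]) T : star (k *: T) = Num.conj k *: star T.
Proof. exact: adjP. Qed.
Let starM S T : star (mul S T) = mul (star T) (star S).
Proof. exact: adjP. Qed.

HB.instance Definition _ := isStarAlgebra.Build R 'L(E)
  mulA mulDl mulDr mulZl mulZr starK starD starZ starM.

End Lmodule.

(* The strict topology: the coarsest one for which T |-> T x and T |-> T^* x    *)
(* are norm continuous for all x.                                               *)
Definition strict_embedding E (T : 'L(E)) : {ptws E -> E} * {ptws E -> E} :=
  (T : E -> E, adj_adj T).

Definition unit_ball E : set 'L(E) := [set T | forall x, `|T x| <= `|x|].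

Definition unitary_op E F (u : 'L(E, F)) : Prop :=
  adj_comp (adjoint u) u = adj_id E /\ adj_comp u (adjoint u) = adj_id F.

(* T |-> u T u^* *)
Definition Ad_unitary E F (u : 'L(E, F)) (T : 'L(E)) : 'L(F) :=
  adj_comp u (adj_comp T (adjoint u)).

End Adjointable.

Notation strict_op E := (initial_topology (@strict_embedding _ _ E)).

Definition strictly_continuous_on_ball (R : realType) (B B' : cstarAlgType R)
    (E : hilbertModType B) (F : hilbertModType B') (f : 'L(E) -> 'L(F)) : Prop :=
  {within (unit_ball (E := E) : set (strict_op E)),
     continuous (f : strict_op E -> strict_op F)}.

(* The multiplier algebra M(A) = L(A), containing A as left multiplications.    *)
Notation multiplier A := 'L(selfmod A).

Section Multipliers.
Context {R : realType} {A : cstarAlgType R}.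

Fact lmul_subproof (a : A) (x y : selfmod A) :
  inner (a ** x : selfmod A) y = inner x (a^† ** y : selfmod A).
Proof. by rewrite /inner /= /self_inner astarM amulA. Qed.

Definition lmul (a : A) : multiplier A := Adjointable (lmul_subproof a).

Lemma lmul_inj : injective lmul.
Proof.
move=> a b /(congr1 (@adjoint _ _ _ _)) h.
apply: (@inner_inj _ _ (selfmod A)) => z; rewrite -inner_star -[RHS]inner_star.
by congr (_ ^†); exact: (congr1 (fun T : multiplier A => T z) h).
Qed.

Lemma amul_lmul (T : multiplier A) a : T ** lmul a = lmul (T a).
Proof. by apply: adjP => x; exact: adj_ract. Qed.

Definition multiplier_extension (b : A -> A)
    (bt : multiplier A -> multiplier A) : Prop :=
  star_iso bt /\ forall a, bt (lmul a) = lmul (b a).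

(* The automorphism of M(A) extending b : A -> A is unique.                     *)
Lemma multiplier_extension_unique (b : A -> A) bt bt' :
  star_iso b -> multiplier_extension b bt -> multiplier_extension b bt' ->
  bt = bt'.
Proof.
move=> [_ [b' _ b'K]].
have key f : multiplier_extension b f -> forall T a, f T (b a) = b (T a).
  move=> [[[_ fM _] _] fb] T a; apply: lmul_inj.
  by rewrite -amul_lmul -fb -fM amul_lmul fb.
move=> h h'; apply/funext => T; apply: adjP => x.
by rewrite -(b'K x) !key.
Qed.

End Multipliers.

Section Nondegenerate.
Context {R : realType}.

Definition tails (I : Type) (le : I -> I -> Prop) : set_system I :=
  [set P | exists i, forall j, le i j -> P j].

Definition directed (I : Type) (le : I -> I -> Prop) : Prop :=
  [/\ inhabited I, forall i, le i i,
      forall i j k, le i j -> le j k -> le i k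
    & forall i j, exists k, le i k /\ le j k].

Definition approximate_unit (A : cstarAlgType R) (I : Type)
    (le : I -> I -> Prop) (e : I -> A) : Prop :=
  [/\ directed le,
      forall i, positive (e i) /\ `|e i| <= 1,
      forall i j, le i j -> positive (e j - e i),
      forall a, e i ** a @[i --> tails le] --> a
    & forall a, a ** e i @[i --> tails le] --> a].

Definition lspan (E : lmodType R[i]) (S : set E) : set E :=
  [set x | exists n (k : 'I_n -> R[i]) (s : 'I_n -> E),
     (forall i, S (s i)) /\ x = \sum_(i < n) k i *: s i].

Context {A B : cstarAlgType R} {E : hilbertModType B}.

Definition nondegenerate_cp (phi : A -> 'L(E)) : Prop :=
  completely_positive phi /\
  exists (I : Type) (le : I -> I -> Prop) (e : I -> A),
    approximate_unit le e /\
    ((phi (e i) : strict_op E) @[i --> tails le] --> (adj_id E : strict_op E)).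

Definition nondegenerate_rep (rho : A -> 'L(E)) : Prop :=
  star_hom rho /\ dense (lspan [set y | exists a x, y = rho a x]).

End Nondegenerate.

Section DynamicalSystems.
Context {R : realType} {G : groupType}.
Implicit Types A B : cstarAlgType R.

Definition cstar_system A (alpha : G -> A -> A) : Prop :=
  (forall g, star_iso (alpha g)) /\
  (forall g h a, alpha (g * h)%g a = alpha g (alpha h a)).

Definition bounded_op (E : normedModType R[i]) (T : E -> E) : Prop :=
  linear T /\ exists M : R[i], forall x, `|T x| <= M * `|x|.

Definition twisted_unitary B (b : B -> B) (E F : hilbertModType B)
    (T : E -> F) : Prop :=
  exists Ts : F -> E,
    [/\ forall x y, inner (T x) y = b (inner x (Ts y)),
        cancel Ts T & cancel T Ts].

Definition hilbert_system B (beta : G -> B -> B) (E : hilbertModType B)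
    (U : G -> E -> E) : Prop :=
  [/\ cstar_system beta,
      forall g, bounded_op (U g),
      (forall x, U 1%g x = x) /\ (forall g h x, U (g * h)%g x = U g (U h x))
    & forall g, twisted_unitary (beta g) (U g)].

Definition covariant A B (alpha : G -> A -> A) (E : hilbertModType B)
    (rho : A -> 'L(E)) (U : G -> E -> E) : Prop :=
  forall g a x, U g (rho a x) = rho (alpha g a) (U g x).

Definition equivariant_corr A B (alpha : G -> A -> A) (beta : G -> B -> B)
    (E : hilbertModType B) (rho : A -> 'L(E)) (U : G -> E -> E) : Prop :=
  [/\ cstar_system alpha, hilbert_system beta U, nondegenerate_rep rho
    & covariant alpha rho U].

Definition positive_equivariant_corr A B (alpha : G -> A -> A)
    (beta : G -> B -> B) (E : hilbertModType B) (phi : A -> 'L(E))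
    (U : G -> E -> E) : Prop :=
  [/\ cstar_system alpha, hilbert_system beta U, nondegenerate_cp phi
    & covariant alpha phi U].

Definition equivariant_map A B (alpha : G -> A -> A) (beta : G -> B -> B)
    (phi : A -> multiplier B) : Prop :=
  forall g, exists2 bt, multiplier_extension (beta g) bt
    & forall a, phi (alpha g a) = bt (phi a).

Definition equivariant_coupling A B (alpha : G -> A -> A) (beta : G -> B -> B)
    (E_B : hilbertModType B) (phi : A -> 'L(E_B)) (W0 : G -> E_B -> E_B)
    (E_A : hilbertModType A) (U : G -> E_A -> E_A) : Prop :=
  [/\ cstar_system alpha, cstar_system beta,
      positive_equivariant_corr alpha beta phi W0 & hilbert_system alpha U].

Definition equivariant_ksgns A B (alpha : G -> A -> A) (beta : G -> B -> B)
    (E : hilbertModType B) (phi : A -> 'L(E)) (U : G -> E -> E)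
    (F : hilbertModType B) (pi : A -> 'L(F)) (V : 'L(E, F))
    (W : G -> F -> F) : Prop :=
  [/\ equivariant_corr alpha beta pi W,
      dense (lspan [set y | exists a x, y = pi a (V x)]),
      forall a, phi a = adj_comp (adjoint V) (adj_comp (pi a) V)
    & forall g x, V (U g x) = W g (V x)].

(* T is a completion of the algebraic tensor product of E and F modulo the null *)
(* space of the semi-inner product <x (x) y, x' (x) y'> = <y, pi(<x, x'>) y'>.  *)
Definition interior_tensor A B (E : hilbertModType A) (F : hilbertModType B)
    (pi : A -> 'L(F)) (T : hilbertModType B) (tens : E -> F -> T) : Prop :=
  [/\ forall y, linear (tens^~ y),
      forall x, linear (tens x),
      (forall x a y, tens (ract x a) y = tens x (pi a y)) /\
      (forall x y b, tens x (ract y b) = ract (tens x y) b),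
      forall x y x' y',
        inner (tens x y) (tens x' y') = inner y (pi (inner x x') y')
    & dense (lspan [set t | exists x y, t = tens x y])].

(* (T, UW) is the interior tensor product with the action U (x) W.              *)
Definition relational_joint_space A B (beta : G -> B -> B)
    (E : hilbertModType A) (U : G -> E -> E) (F : hilbertModType B)
    (pi : A -> 'L(F)) (W : G -> F -> F) (T : hilbertModType B)
    (tens : E -> F -> T) (UW : G -> T -> T) : Prop :=
  [/\ interior_tensor pi tens, hilbert_system beta UW
    & forall g x y, UW g (tens x y) = tens (U g x) (W g y)].

(* Fixed points of Ad(U)_g T = U_g T U_g^{-1}.                                  *)
Definition fixed_points B (E : hilbertModType B) (U : G -> E -> E) :
    set 'L(E) :=
  [set T | forall g x, U g (T (U g^-1%g x)) = T x].

(* A completely positive map into the fixed-point algebra is one into L(T) with *)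
(* fixed values: positivity of an element of a C*-subalgebra does not depend on *)
(* the ambient algebra. The value S (x) I is given on elementary tensors.       *)
Definition relativization_map A B (E : hilbertModType A) (U : G -> E -> E)
    (F : hilbertModType B) (T : hilbertModType B) (tens : E -> F -> T)
    (UW : G -> T -> T) (L : 'L(E) -> 'L(T)) : Prop :=
  [/\ forall S, fixed_points UW (L S),
      completely_positive L,
      strictly_continuous_on_ball L
    & forall S, fixed_points U S -> forall x y, L S (tens x y) = tens (S x) y].

End DynamicalSystems.

Definition unital_extension (R : realType) (A B : cstarAlgType R)
    (F : hilbertModType B) (pi : A -> 'L(F)) (pit : multiplier A -> 'L(F)) :
    Prop :=
  [/\ star_hom pit, pit (adj_id _) = adj_id F
    & forall a, pit (lmul a) = pi a].

(* Main.v *)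
(* Since [(x (x) y, x' (x) y')] and [(pi(x) y, pi(x') y')] have the same inner    *)
(* products, [x (x) y |-> pi(x) y] extends to a unitary [A (x)_pi F -> F], which *)
(* transports everything; the multiplier [S] acts on [F] by                      *)
(* [pi(a) y |-> pi(S a) y].  The analytic input is that *-homomorphisms and      *)
(* adjointable operators are bounded.  For the former, a selfadjoint [h] of norm *)
(* at most 1/2 is the mean of the unitaries [h +- i sqrt(1 - h^2)], which a      *)
(* representation on [F] turns into isometries; this avoids spectral theory.     *)
(* For the latter a gliding hump argument is used, and an approximate unit then  *)
(* bounds the operator [pi(a) y |-> pi(S a) y].                                  *)
Require Import Defs.
From HB Require Import structures.
From mathcomp Require Import all_boot all_order all_algebra complex.
From mathcomp Require Import all_classical all_reals all_analysis.
From mathcomp Require Import ring lra.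

Set Implicit Arguments.
Unset Strict Implicit.
Unset Printing Implicit Defensive.
Import Order.TTheory GRing.Theory Num.Theory.
Import numFieldNormedType.Exports.
Local Open Scope classical_set_scope.
Local Open Scope ring_scope.

(** The equivalence rests on two facts. Each [beta g] is a [beta g]-adjointable unitary of
    [selfmod B] with adjoint [beta g^-1], bounded by [star_endo_bounded]. Covariance says [phi
    (alpha g a) = beta g \o phi a \o beta g^-1], and this conjugation is the extension of [beta g]
    to multipliers, so covariance is equivariance ([covariant_equivariant]).

    For the rest, [<a (x) y, b (x) z> = <y, pi(a^† b) z> = <pi(a) y, pi(b) z>] on two total
    families, so [unitary_of_isometry] yields [u]. Conjugation by [u] is an isomorphism that carries
    fixed points, complete positivity and strict continuity in both directions. The condition
    [L S (a (x) y) = S a (x) y] becomes [pi(a) y |-> pi(S a) y], the formula that characterizes the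
    extension of [pi] at [S]. This operator is bounded because, on a finite combination, it is
    approximated by the operators [pi(S b)] with [b] in an approximate unit
    ([rep_multiplier_bounded]).

    Operators are built from their values on total families ([adjointable_extension]) and compared
    there ([adjointable_eq_total]). The continuity used comes from [adj_bounded] and
    [star_hom_bounded]; only the existence of some constant matters. *)

(** * Real-valued norms and sequences with geometric increments *)

Section RealNorm.
Context {R : realType} {V : normedModType R[i]}.
Implicit Types (x y z : V) (r e : R).

(** Norms take values in [R[i]], whose order is partial; the real part allows real arithmetic and
    case analysis on inequalities. *)
Definition rnorm x : R := complex.Re `|x|.

Lemma rnormE x : `|x| = (rnorm x)%:C%C.
Proof. by rewrite RRe_real// ger0_real. Qed.

Lemma rnorm_ge0 x : 0 <= rnorm x.
Proof. by rewrite -(@ler0c R) -rnormE. Qed.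

Lemma rnorm0 : rnorm (0 : V) = 0.
Proof. by rewrite /rnorm normr0. Qed.

Lemma rnorm_eq0 x : rnorm x = 0 -> x = 0.
Proof. by move=> h; apply/normr0_eq0; rewrite rnormE h. Qed.

Lemma rnorm_gt0 x : x != 0 -> 0 < rnorm x.
Proof.
move=> x0; rewrite lt_def rnorm_ge0 andbT.
by apply: contra_neq x0 => /rnorm_eq0.
Qed.

Lemma rnormD x y : rnorm (x + y) <= rnorm x + rnorm y.
Proof. rewrite -lecR rmorphD/= -!rnormE; exact: ler_normD. Qed.

Lemma rnormN x : rnorm (- x) = rnorm x.
Proof. by rewrite /rnorm normrN. Qed.

Lemma rnormB x y : rnorm (x - y) <= rnorm x + rnorm y.
Proof. by rewrite -(rnormN y) rnormD. Qed.

Lemma rdistC x y : rnorm (x - y) = rnorm (y - x).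
Proof. by rewrite -rnormN opprB. Qed.

Lemma rnormZr r x : rnorm (r%:C%C *: x) = `|r| * rnorm x.
Proof.
apply: complexI; rewrite rmorphM/= -!rnormE normrZ; congr (_ * _).
by rewrite normc_def/= expr0n addr0 sqrtr_sqr.
Qed.

Lemma rnormZ (k : R[i]) x : rnorm (k *: x) = Normc.normc k * rnorm x.
Proof.
by apply: complexI; rewrite rmorphM/= -!rnormE normrZ.
Qed.

Lemma normc_ge0 (k : R[i]) : 0 <= Normc.normc k.
Proof. by case: k => a b; exact: sqrtr_ge0. Qed.

Lemma rnormZi x : rnorm ('i%C *: x) = rnorm x.
Proof.
by rewrite rnormZ/= expr0n expr1n add0r sqrtr1 mul1r.
Qed.

Lemma half_double x : (2^-1)%:C%C *: (x + x) = x.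
Proof.
rewrite -[X in X + X]scale1r -scalerDl scalerA -(rmorph1 (real_complex R)).
by rewrite -rmorphD -rmorphM/= (_ : 2^-1 * (1 + 1) = 1) ?scale1r//; lra.
Qed.

Lemma rnorm_le0 x : (forall e, 0 < e -> rnorm x <= e) -> x = 0.
Proof.
move=> h; apply: rnorm_eq0; apply/eqP; rewrite eq_le rnorm_ge0 andbT.
by apply/ler_addgt0Pr => e e0; rewrite add0r h.
Qed.

Lemma nbhs_rnorm x (P : set V) : nbhs x P ->
  exists2 e, 0 < e & forall y, rnorm (x - y) < e -> P y.
Proof.
move=> /nbhs_normP[e /= e0 h].
have eE : (complex.Re e)%:C%C = e by rewrite RRe_real// gtr0_real.
exists (complex.Re e); first by rewrite -(@ltcR R) eE.
by move=> y; rewrite -ltcR -rnormE eE; exact: h.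
Qed.

Lemma dense_rnorm (D : set V) x e : dense D -> 0 < e ->
  exists2 y, D y & rnorm (x - y) < e.
Proof.
move=> dD e0.
have e0' : 0 < e%:C%C by rewrite (@ltcR R 0).
have := dD (ball x e%:C%C) _ (ball_open _ _).
case; first by exists x; exact: ballxx.
by move=> y [+ Dy]; rewrite -ball_normE/= rnormE ltcR; exists y.
Qed.

End RealNorm.

(** The increments sum to at most [2^-1 ^+ n] from [n] on. The explicit rate at the limit lets later
    identities be proved by estimates. *)
Lemma fast_cauchy_cvg (R : realType) (V : completeNormedModType R[i])
    (u : nat -> V) :
  (forall n, rnorm (u n - u n.+1) <= 2^-1 ^+ n.+1) ->
  exists x, forall n, rnorm (u n - x) <= 2^-1 ^+ n.
Proof.
move=> hu.
have e0 n : 0 < 2^-1 ^+ n :> R by rewrite exprn_gt0.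
(* Subtracting the tail [2^-1 ^+ (n + m)] strengthens the bound enough for induction on [m]. *)
have hd n m : rnorm (u n - u (n + m)%N) <= 2^-1 ^+ n - 2^-1 ^+ (n + m).
  elim: m => [|m ih]; first by rewrite addn0 !subrr rnorm0.
  rewrite addnS -(subrK (u (n + m)%N) (u n)) -addrA.
  apply: (le_trans (rnormD _ _)); apply: (le_trans (lerD ih (hu _))).
  by rewrite exprSr; lra.
have hd' n m : (n <= m)%N -> rnorm (u n - u m) <= 2^-1 ^+ n.
  move=> /subnKC <-; apply: (le_trans (hd _ _)).
  by rewrite lerBlDr lerDl ltW.
have cvgr0 : (fun n : nat => 2^-1 ^+ n : R) @ \oo --> (0 : R).
  by apply: cvg_expr; rewrite ger0_norm; lra.
have : cvg (u @ \oo).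
  apply: cauchy_cvg; apply: cauchy_exP => e e_gt0.
  have eE : (complex.Re e)%:C%C = e by rewrite RRe_real// gtr0_real.
  have Re0 : 0 < complex.Re e by rewrite -(@ltcR R) eE.
  have /cvgrPdist_lt/(_ _ Re0)[N _ hN] := cvgr0.
  exists (u N); exists N => // n /= Nn; rewrite -ball_normE/= rnormE -eE ltcR.
  apply: le_lt_trans (hd' _ _ Nn) _.
  have := hN N (leqnn _); by rewrite /= sub0r normrN ger0_norm// ltW.
move=> /cvg_ex[x ux]; exists x => n; apply/ler_addgt0Pr => e e_gt0.
have e0' : 0 < e%:C%C by rewrite (@ltcR R 0).
have /cvgrPdist_lt/(_ _ e0')[N _ hN] := ux.
have := hN (maxn n N) (leq_maxr _ _).
rewrite /= rnormE ltcR => hN'.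
rewrite -(subrK (u (maxn n N)) (u n)) -addrA.
apply: (le_trans (rnormD _ _)); rewrite lerD ?hd' ?leq_maxl// rdistC ltW//.
Qed.

(** * Boundedness of the inner product *)

Section InnerBound.
Context {R : realType} {B : cstarAlgType R} {E : hilbertModType B}.
Implicit Types x y z : E.

Lemma rnorm_inner_self x : rnorm (inner x x) = rnorm x ^+ 2.
Proof. by apply: complexI; rewrite rmorphXn/= -!rnormE norm_inner. Qed.

Lemma innerNr x y : inner x (- y) = - inner x y.
Proof. by rewrite -scaleN1r innerZr scaleN1r. Qed.

Lemma innerBr x y z : inner x (y - z) = inner x y - inner x z.
Proof. by rewrite innerDr innerNr. Qed.

Lemma innerBl x y z : inner (x - y) z = inner x z - inner y z.
Proof. by rewrite innerDl -scaleN1r innerZl rmorphN1 scaleN1r. Qed.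

Lemma conj_real (r : R) : Num.conj (r%:C%C) = r%:C%C.
Proof. by apply/CrealP; apply/complex_realP; exists r. Qed.

Lemma conj_i : Num.conj ('i%C : R[i]) = - 'i%C.
Proof. by apply/eqP; rewrite eq_complex /= oppr0 !eqxx. Qed.

(* Polarization replaces the Cauchy-Schwarz inequality (constant 1), whose proof *)
(* needs the order structure of B.                                              *)
Lemma rnorm_inner x y : rnorm (inner x y) <= 6 * rnorm x * rnorm y.
Proof.
have key (u v : E) : rnorm u = 1 -> rnorm v = 1 -> rnorm (inner u v) <= 6.
  move=> u1 v1.
  (* The bound is [4 + 1 + 1], from [|u + w|^2], [|u|^2] and [|w|^2]. Taking [w = v] and
     [w = 'i *: v] bounds the sum and the difference of [inner u v] and [inner v u]. *)
  have P (w : E) : rnorm w = 1 -> rnorm (inner u w + inner w u) <= 6.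
    move=> w1; have -> : inner u w + inner w u =
        inner (u + w) (u + w) - (inner u u + inner w w).
      by rewrite innerDl !innerDr opprD addrACA addrK [_ - _]addrAC subrr add0r.
    apply: (le_trans (rnormB _ _)); apply: (le_trans (lerD (lexx _) (rnormD _ _))).
    rewrite !rnorm_inner_self u1 w1 expr1n.
    have : rnorm (u + w) ^+ 2 <= 2 ^+ 2.
      by rewrite lerXn2r ?nnegrE ?rnorm_ge0// (le_trans (rnormD _ _))// u1 w1.
    by rewrite expr2; lra.
  have h1 := P v v1.
  have h2 := P ('i%C *: v) (etrans (rnormZi v) v1).
  rewrite innerZl innerZr conj_i scaleNr -scalerBr rnormZi in h2.
  rewrite -[X in X <= _]mul1r.
  have -> : inner u v = (2^-1)%:C%C *:
      ((inner u v + inner v u) + (inner u v - inner v u)).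
    by rewrite addrACA subrr addr0 half_double.
  rewrite rnormZr ger0_norm//.
  have := rnormD (inner u v + inner v u) (inner u v - inner v u).
  lra.
have [->|x0] := eqVneq x 0; first by rewrite inner0l !rnorm0 mulr0 mul0r.
have [->|y0] := eqVneq y 0; first by rewrite inner0r !rnorm0 mulr0.
have nx := rnorm_gt0 x0; have ny := rnorm_gt0 y0.
have unit (z : E) : z != 0 -> rnorm (((rnorm z)^-1)%:C%C *: z) = 1.
  move=> z0; rewrite rnormZr ger0_norm ?invr_ge0 ?rnorm_ge0// mulVf//.
  by rewrite gt_eqF// rnorm_gt0.
have := key _ _ (unit _ x0) (unit _ y0).
rewrite innerZl innerZr conj_real scalerA -rmorphM/= rnormZr ger0_norm; last first.
  by rewrite mulr_ge0// invr_ge0 ltW.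
rewrite -invfM mulrC ler_pdivrMr ?mulr_gt0// => h.
by apply: (le_trans h); rewrite le_eqVlt; apply/orP; left; apply/eqP; ring.
Qed.

End InnerBound.

(** * Algebra of linear maps, involutions and C*-norms *)

Section RawLinear.
Context {R : realType} {U V : lmodType R[i]} {f : U -> V}.
Hypothesis lf : linear f.

Let g : {linear U -> V} := HB.pack f (GRing.isLinear.Build _ _ _ _ _ lf).

Lemma lin0 : f 0 = 0. Proof. exact: (linear0 g). Qed.
Lemma linD x y : f (x + y) = f x + f y. Proof. exact: (linearD g). Qed.
Lemma linB x y : f (x - y) = f x - f y. Proof. exact: (linearB g). Qed.
Lemma linZ k x : f (k *: x) = k *: f x. Proof. exact: (linearZ_LR g). Qed.

End RawLinear.

Section StarAlgebraTheory.
Context {R : realType} {A : starAlgType R}.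
Implicit Types a b c : A.

Lemma amulBl a b c : (a - b) ** c = a ** c - b ** c.
Proof. by rewrite amulDl -scaleN1r amulZl scaleN1r. Qed.

Lemma amulBr a b c : c ** (a - b) = c ** a - c ** b.
Proof. by rewrite amulDr -scaleN1r amulZr scaleN1r. Qed.

Lemma amul0l a : 0 ** a = 0.
Proof. by rewrite -(scale0r a) amulZl !scale0r. Qed.

Lemma amul0r a : a ** 0 = 0.
Proof. by rewrite -(scale0r a) amulZr !scale0r. Qed.

Lemma astarB a b : (a - b)^† = a^† - b^†.
Proof. by rewrite astarD -scaleN1r astarZ rmorphN1 scaleN1r. Qed.

Lemma astar0 : (0 : A)^† = 0.
Proof. by rewrite -(scale0r (0 : A)) astarZ rmorph0 !scale0r. Qed.

End StarAlgebraTheory.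

Section CStarNorm.
Context {R : realType} {A : cstarAlgType R}.
Implicit Types a b : A.

Lemma rnorm_amul a b : rnorm (a ** b) <= rnorm a * rnorm b.
Proof. by rewrite -lecR rmorphM/= -!rnormE norm_amul_le. Qed.

Lemma rnorm_cstar a : rnorm (a^† ** a) = rnorm a ^+ 2.
Proof. by apply: complexI; rewrite rmorphXn/= -!rnormE cstar_identity. Qed.

(** Divide [|b|^2 = |b^† b| <= |b^†| |b|] by [|b|], then apply the result to [b^†]. *)
Lemma rnorm_star a : rnorm a^† = rnorm a.
Proof.
have le b : rnorm b <= rnorm b^†.
  have [->|b0] := eqVneq b 0; first by rewrite rnorm0 rnorm_ge0.
  rewrite -(ler_pM2r (rnorm_gt0 b0)) -expr2 -rnorm_cstar.
  exact: rnorm_amul.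
apply/eqP; rewrite eq_le le andbT. have := le a^†; by rewrite astarK.
Qed.

End CStarNorm.

(** * Square roots by fixed-point iteration *)

Section SquareRoot.
Context {R : realType}.

Lemma small_pow (C e : R) : 0 < e -> exists n, C * 2^-1 ^+ n < e.
Proof.
move=> e0; exists (Num.truncn (C / e)).+1.
have h : C / e < 2 ^+ (Num.truncn (C / e)).+1.
  apply: (lt_trans (Num.Theory.truncnS_gt _)).
  by rewrite -natrX ltr_nat ltn_expl.
by rewrite exprVn ltr_pdivrMr ?exprn_gt0// mulrC -ltr_pdivrMr.
Qed.

Lemma rnorm_pow0 (V : normedModType R[i]) (x : V) C :
  (forall n, rnorm x <= C * 2^-1 ^+ n) -> x = 0.
Proof.
move=> h; apply: rnorm_le0 => e /(small_pow C)[n hn].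
exact: le_trans (h n) (ltW hn).
Qed.

(* With [y] the fixed point of [y |-> (h^2 + y^2) / 2], the element [1 - y] of  *)
(* the unitization is a square root of [1 - h^2].                               *)
Lemma selfadjoint_sqrt (A : cstarAlgType R) (h : A) :
  h^† = h -> rnorm h <= 2^-1 ->
  exists y : A, [/\ y^† = y, y ** h = h ** y & y + y = h ** h + y ** y].
Proof.
move=> hh h2.
pose f (y : A) := (2^-1)%:C%C *: (h ** h + y ** y).
pose u n := iter n f 0.
have un n : rnorm (u n) <= 2^-1.
  elim: n => [|n ih] /=; first by rewrite rnorm0.
  rewrite rnormZr ger0_norm//.
  have := rnormD (h ** h) (u n ** u n).
  have := rnorm_amul h h; have := rnorm_amul (u n) (u n).
  have := rnorm_ge0 h; have := rnorm_ge0 (u n).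
  rewrite -/(u n); nra.
(* On the ball of radius 1/2 this makes [f] a contraction with factor 1/2. *)
have sqB (a b : A) : rnorm (a ** a - b ** b) <=
    rnorm (a - b) * (rnorm a + rnorm b).
  have -> : a ** a - b ** b = (a - b) ** a + b ** (a - b).
    by rewrite amulBl amulBr addrA subrK.
  apply: (le_trans (rnormD _ _)); apply: (le_trans (lerD (rnorm_amul _ _)
    (rnorm_amul _ _))).
  by rewrite [rnorm b * _]mulrC -mulrDr.
have ud n : rnorm (u n - u n.+1) <= 2^-1 ^+ n.+1.
  elim: n => [|n ih] /=.
    by rewrite sub0r rnormN (le_trans (un 1%N))// expr1.
  rewrite /f -/(u n) -/(f (u n)) -scalerBr rnormZr ger0_norm//.
  rewrite opprD addrACA subrr add0r exprS ler_pM2l//.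
  apply: (le_trans (sqB _ _)); apply: le_trans ih.
  have := rnorm_ge0 (u n - f (u n)); have := un n; have := un n.+1.
  rewrite /= -/(u n); nra.
have [y hy] : exists y : A, forall n, rnorm (u n - y) <= 2^-1 ^+ n.
  exact: fast_cauchy_cvg ud.
have us n : (u n)^† = u n.
  elim: n => [|n ih] /=; first by rewrite astar0.
  by rewrite astarZ conj_real astarD !astarM hh -/(u n) ih.
have uh n : u n ** h = h ** u n.
  elim: n => [|n ih]; first by rewrite /= amul0l amul0r.
  have uuh : u n ** u n ** h = h ** (u n ** u n).
    by rewrite -amulA ih amulA ih amulA.
  by rewrite /= -/(u n) amulZl amulZr amulDl amulDr uuh -[h ** h ** h]amulA.
(* The iterates satisfy the first two identities exactly, and the third between [u n.+1] and [u n];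
   so each defect of [y] is at most a constant times [2^-1 ^+ n]. *)
exists y; split.
- apply/eqP; rewrite -subr_eq0; apply/eqP/(@rnorm_pow0 _ _ 2) => n.
  have -> : y^† - y = (u n - y) - (u n - y)^†.
    by rewrite astarB us opprB [RHS]addrC addrA subrK.
  apply: (le_trans (rnormB _ _)); rewrite rnorm_star; have := hy n; lra.
- apply/eqP; rewrite -subr_eq0; apply/eqP/(@rnorm_pow0 _ _ 1) => n.
  have -> : y ** h - h ** y = h ** (u n - y) - (u n - y) ** h.
    by rewrite amulBl amulBr uh opprB [RHS]addrC addrA subrK.
  apply: (le_trans (rnormB _ _)); have := rnorm_amul h (u n - y).
  have := rnorm_amul (u n - y) h; have := hy n; have := rnorm_ge0 (u n - y).
  have := rnorm_ge0 h; nra.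
- apply/eqP; rewrite -subr_eq0; apply/eqP/(@rnorm_pow0 _ _ 4) => n.
  have e : u n.+1 + u n.+1 = h ** h + u n ** u n.
    by rewrite /= -/(u n) /f -scalerDr half_double.
  have -> : y + y - (h ** h + y ** y) =
      (u n ** u n - y ** y) - ((u n.+1 - y) + (u n.+1 - y)).
    by rewrite addrACA -opprD e opprB [RHS]addrC !opprD !addrA subrK.
  apply: (le_trans (rnormB _ _)).
  apply: (le_trans (lerD (sqB _ _) (rnormD _ _))).
  have := hy n.+1; have := hy n; have := rnorm_ge0 (u n - y).
  have := un n; have := rnormB (u n) (u n - y); rewrite opprB addrC subrK exprS.
  have : 2^-1 ^+ n <= 1 :> R by rewrite exprn_ile1//; lra.
  nra.
Qed.

End SquareRoot.

(** * Adjointable operators are bounded *)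

Section AdjointableLinear.
Context {R : realType} {B : cstarAlgType R} {E F : hilbertModType B}.
Variable T : 'L(E, F).
Implicit Types x y : E.

Lemma adj0 : T 0 = 0. Proof. exact: (lin0 (adj_linear T)). Qed.
Lemma adjD x y : T (x + y) = T x + T y.
Proof. exact: (linD (adj_linear T)). Qed.
Lemma adjB x y : T (x - y) = T x - T y.
Proof. exact: (linB (adj_linear T)). Qed.
Lemma adjZ k x : T (k *: x) = k *: T x.
Proof. exact: (linZ (adj_linear T)). Qed.

(* Gliding hump: if [T] were unbounded, one could build a fast Cauchy sequence  *)
(* [s n] with [|T (s n)| >= n] whose increments are so small with respect to    *)
(* [|T^* T (s n)|] that [|<T (s n), T s>|] is about [|T (s n)|^2] at the limit. *)
Lemma adj_bounded : exists2 C : R, 0 <= C & forall x, rnorm (T x) <= C * rnorm x.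
Proof.
apply: contrapT => unb.
have big (C : R) : 0 <= C -> exists x, C * rnorm x < rnorm (T x).
  move=> C0; apply: contrapT => h; apply: unb; exists C => // x.
  by rewrite leNgt; apply/negP => hx; apply: h; exists x.
(* A state is a point with a radius limiting all later moves. The new radius is at most half the old
   one, and small against [T^* T] at the new point, so that later moves barely change the inner
   product of its image with the images of later points. *)
have step (p : nat * (E * R)) : exists q : E * R, 0 < p.2.2 ->
    [/\ rnorm (p.2.1 - q.1) <= p.2.2 / 2, p.1%:R <= rnorm (T q.1),
        0 < q.2, q.2 <= p.2.2 / 2 & rnorm (adj_adj T (T q.1)) * q.2 <= 1].
  case: p => n [s d] /=; have [d0|_] := boolP (0 < d); last by exists (s, d).
  suff [s' [h1 h2]] : exists s', rnorm (s - s') <= d / 2 /\ n%:R <= rnorm (T s').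
    set t := rnorm (adj_adj T (T s')).
    have t0 : 0 <= t by exact: rnorm_ge0.
    have t1 : 0 < (1 + t)^-1 by rewrite invr_gt0; lra.
    exists (s', Num.min (d / 2) (1 + t)^-1) => _ /=; split => //.
    - by rewrite lt_min t1 andbT; lra.
    - by rewrite ge_min lexx.
    - apply: (@le_trans _ _ (t * (1 + t)^-1)).
        by rewrite ler_wpM2l// ge_min lexx orbT.
      by rewrite ler_pdivrMr; lra.
  have C0 : 0 <= n%:R * (2 / d) by rewrite !mulr_ge0// invr_ge0 ltW.
  have [x hx] := big _ C0.
  have x0 : 0 < rnorm x.
    apply: rnorm_gt0; apply: contraTneq hx => ->.
    by rewrite adj0 !rnorm0 mulr0 ltxx.
  pose w := (d / 2 / rnorm x)%:C%C *: x.
  have c0 : 0 < d / 2 / rnorm x by rewrite !divr_gt0.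
  have nw : rnorm w = d / 2.
    by rewrite rnormZr gtr0_norm// divfK// gt_eqF.
  have nTw : n%:R <= rnorm (T w).
    rewrite adjZ rnormZr gtr0_norm//.
    have -> : n%:R = d / 2 / rnorm x * (n%:R * (2 / d) * rnorm x) :> R.
      by field; rewrite !gt_eqF.
    by rewrite ler_pM2l// ltW.
  (* [T w + T w] is the difference of the two images and [|T w| >= n], so they cannot both be
     shorter than [n]. *)
  have : n%:R <= rnorm (T (s + w)) \/ n%:R <= rnorm (T (s - w)).
    apply: contrapT => /not_orP[/negP + /negP]; rewrite -!ltNge => h1 h2.
    have : rnorm (T w + T w) <= rnorm (T (s + w)) + rnorm (T (s - w)).
      have -> : T w + T w = T (s + w) - T (s - w).
        by rewrite adjB adjD opprB [T s + T w]addrC addrACA subrr addr0.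
      exact: rnormB.
    have := half_double (T w) => /(congr1 rnorm).
    rewrite rnormZr gtr0_norm//; lra.
  case=> h; [exists (s + w)|exists (s - w)]; split=> //.
    by rewrite opprD addrA subrr sub0r rnormN nw.
  by rewrite opprB addrC subrK nw.
have [g hg] := choice step.
pose fix st n : E * R := if n is n'.+1 then g (n', st n') else (0, 1).
have dpos n : 0 < (st n).2.
  by elim: n => [|n ih] //=; have [] := hg (n, st n) ih.
have st_step n := hg (n, st n) (dpos n).
have dpow n : (st n).2 <= 2^-1 ^+ n.
  elim: n => [|n ih] //=; have [_ _ _ + _] := st_step n.
  by rewrite /= exprS; lra.
have tele n m : rnorm ((st n).1 - (st (n + m)%N).1) <= (st n).2 - (st (n + m)%N).2.
  elim: m => [|m ih]; first by rewrite addn0 !subrr rnorm0.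
  rewrite addnS -(subrK (st (n + m)%N).1 (st n).1) -addrA.
  apply: (le_trans (rnormD _ _)).
  have [h1 _ _ h2 _] := st_step (n + m)%N.
  move: h1 h2 ih; rewrite /=; lra.
have [n|s hs] := @fast_cauchy_cvg _ _ (fun n => (st n).1).
  have [h1 _ _ h2 _] := st_step n; apply: (le_trans h1).
  by rewrite exprS /=; have := dpow n; lra.
have lim n : rnorm ((st n).1 - s) <= 2 * (st n).2.
  have [m hm] := small_pow 1 (dpos n).
  rewrite -(subrK (st (n + m)%N).1 (st n).1) -addrA.
  apply: (le_trans (rnormD _ _)).
  have := tele n m; have := hs (n + m)%N; have := dpos (n + m)%N.
  have : 2^-1 ^+ (n + m) <= 2^-1 ^+ m :> R.
    by rewrite exprD ler_piMl ?exprn_ge0// exprn_ile1//; lra.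
  rewrite mul1r in hm; lra.
(* For [v] the point of stage [n.+1], [|T v|^2 <= 6 |T v| |T s| + 12 <= K |T v|], the last step
   because [|T v| >= 1]; this contradicts [|T v| >= n > K]. *)
set K := 6 * rnorm (T s) + 12.
pose n := (Num.truncn K).+1.
have nK : K < n%:R by exact: Num.Theory.truncnS_gt.
have [_ + _ _ +] := st_step n; rewrite -/(st n.+1).
have := lim n.+1; have := dpos n.+1.
rewrite /=; set v := (g _).1; set d := (g _).2.
move=> d0 vs nv td.
have e : inner (T v) (T v) = inner (T v) (T s) + inner (adj_adj T (T v)) (v - s).
  by rewrite adj_prop' adjB innerBr addrC subrK.
have := rnormD (inner (T v) (T s)) (inner (adj_adj T (T v)) (v - s)).
rewrite -e rnorm_inner_self.
have h1 := rnorm_inner (T v) (T s).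
have h2 := rnorm_inner (adj_adj T (T v)) (v - s).
have h3 : 6 * rnorm (adj_adj T (T v)) * rnorm (v - s) <= 12.
  have : rnorm (adj_adj T (T v)) * rnorm (v - s) <=
      rnorm (adj_adj T (T v)) * (2 * d) by rewrite ler_wpM2l ?rnorm_ge0.
  nra.
have K12 : 12 <= K by rewrite /K; have := rnorm_ge0 (T s); lra.
have : rnorm (T v) * K < rnorm (T v) ^+ 2.
  by rewrite expr2 ltr_pM2l; lra.
by rewrite /K; have := rnorm_ge0 (T s); nra.
Qed.

End AdjointableLinear.

Lemma adj_subE (R : realType) (B : cstarAlgType R) (E : hilbertModType B)
    (S T : 'L(E)) x : (S - T) x = S x - T x.
Proof. by change (S x + (-1) *: T x = S x - T x); rewrite scaleN1r. Qed.

(** * Star-homomorphisms are bounded *)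

Section StarHomBounded.
Context {R : realType} {A B : cstarAlgType R} {F : hilbertModType B}.

(** In [(P - k Q)(P + k Q)] the mixed terms cancel and [k * k = -1] leaves [P^2 + Q^2 = 1]. A
    general [k] serves both ['i] and its negative. *)
Lemma inner_skew_sum (P Q : 'L(F)) (k : R[i]) x :
  P^† = P -> Q^† = Q -> P ** Q = Q ** P -> P ** P + Q ** Q = adj_id F ->
  Num.conj k = - k -> k * k = -1 ->
  inner (P x + k *: Q x) (P x + k *: Q x) = inner x x.
Proof.
move=> hP hQ PQ PPQQ hk kk.
have aP y z : inner (P y) z = inner y (P z) by rewrite adj_prop -[in RHS]hP.
have aQ y z : inner (Q y) z = inner y (Q z) by rewrite adj_prop -[in RHS]hQ.
rewrite innerDl !innerDr !innerZl !innerZr !aP !aQ hk scalerA mulNr kk opprK.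
rewrite scale1r scaleNr.
have -> : Q (P x) = P (Q x) by exact: (congr1 (fun T : 'L(F) => T x) (esym PQ)).
rewrite addrA addrK -innerDr.
by congr (inner x _); exact: (congr1 (fun T : 'L(F) => T x) PPQQ).
Qed.

Variable rho : A -> 'L(F).
Hypothesis hrho : star_hom rho.

(* By selfadjoint_sqrt, [h] is half the sum of the unitaries [h +- i (1 - y)].  *)
Lemma star_hom_selfadjoint_half (h : A) x :
  h^† = h -> rnorm h <= 2^-1 -> rnorm (rho h x) <= rnorm x.
Proof.
move=> hh h2; have [lr mr sr] := hrho.
have [y [ys yh yy]] := selfadjoint_sqrt hh h2.
(* The root [1 - y] lives in the unitization, so it is formed after applying [rho]. Applying [rho]
   to [y + y = h ** h + y ** y] gives [rho(h)^2 + Q^2 = 1]. *)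
pose Q : 'L(F) := adj_id F - rho y.
have QE z : Q z = z - rho y z by exact: adj_subE.
have nrm k : Num.conj k = - k -> k * k = -1 ->
    rnorm (rho h x + k *: Q x) = rnorm x.
  move=> hk kk; apply/eqP; rewrite -(@eqrXn2 _ 2) ?rnorm_ge0//.
  rewrite -!rnorm_inner_self inner_skew_sum//.
  - by rewrite -sr hh.
  - by rewrite /Q astarB -sr ys; congr (_ - _); exact: adjP.
  - rewrite /Q amulBl amulBr -!mr yh; congr (_ - _); exact: adjP.
  - apply: adjP => z; change (rho h (rho h z) + Q (Q z) = z).
    have -> : rho h (rho h z) = rho y z + rho y z - rho y (rho y z).
      have := congr1 (fun a => rho a z) yy; rewrite !(linD lr) !mr/=.
      by move=> ->; rewrite addrK.
    rewrite !QE adjB opprB [z - rho y z + _]addrC addrA.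
    by rewrite [_ - _ + (_ - rho y z)]addrA subrK addrK addrC subrK.
have h1 := nrm 'i%C conj_i (sqr_i R).
have h3 : rnorm (rho h x + (- 'i%C) *: Q x) = rnorm x.
  by apply: nrm; rewrite ?rmorphN/= ?conj_i// mulrNN; exact: (sqr_i R).
have := half_double (rho h x) => /(congr1 rnorm) <-.
rewrite rnormZr gtr0_norm//.
have -> : rho h x + rho h x =
    (rho h x + 'i%C *: Q x) + (rho h x + (- 'i%C) *: Q x).
  by rewrite addrACA scaleNr subrr addr0.
have := rnormD (rho h x + 'i%C *: Q x) (rho h x + (- 'i%C) *: Q x).
rewrite h1 h3; lra.
Qed.

(** Rescale [h] to norm 1/2. *)
Lemma star_hom_selfadjoint (h : A) x :
  h^† = h -> rnorm (rho h x) <= 2 * rnorm h * rnorm x.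
Proof.
move=> hh; have [lr _ _] := hrho.
have [->|h0] := eqVneq h 0.
  by rewrite (lin0 lr) !rnorm0 mulr0 mul0r.
have n0 := rnorm_gt0 h0.
pose c := (2 * rnorm h)^-1; have c0 : 0 < c by rewrite invr_gt0 mulr_gt0.
have := @star_hom_selfadjoint_half (c%:C%C *: h) x.
rewrite astarZ conj_real hh => /(_ erefl).
rewrite rnormZr gtr0_norm// (linZ lr).
have -> : c * rnorm h = 2^-1 by rewrite /c invfM mulrAC -mulrA mulfV ?gt_eqF ?mulr1.
move=> /(_ (lexx _)).
rewrite -[rnorm _]/(rnorm (c%:C%C *: rho h x)) rnormZr gtr0_norm//.
by rewrite mulrC -ler_pdivlMr// /c invrK mulrC.
Qed.

(** Here [a] is half of [h1 - 'i *: h2], with selfadjoint parts of norm at most [2 |a|]; each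
    contributes [4 |a| |x|] before halving. *)
Lemma star_hom_bounded (a : A) x : rnorm (rho a x) <= 4 * rnorm a * rnorm x.
Proof.
have [lr _ _] := hrho.
pose h1 := a + a^†; pose h2 := 'i%C *: (a - a^†).
have s1 : h1^† = h1 by rewrite /h1 astarD astarK addrC.
have s2 : h2^† = h2.
  by rewrite /h2 astarZ conj_i astarB astarK scaleNr -scalerN opprB.
have n1 : rnorm h1 <= 2 * rnorm a.
  by have := rnormD a a^†; rewrite rnorm_star -/h1; lra.
have n2 : rnorm h2 <= 2 * rnorm a.
  by have := rnormB a a^†; rewrite rnorm_star /h2 rnormZi; lra.
have e : a + a = h1 - 'i%C *: h2.
  rewrite /h1 /h2 scalerA; have -> : 'i%C * 'i%C = -1 :> R[i] by exact: sqr_i.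
  by rewrite scaleN1r opprK addrACA subrr addr0.
have b1 := star_hom_selfadjoint x s1.
have b2 := star_hom_selfadjoint x s2.
have := half_double (rho a x) => /(congr1 rnorm) <-.
rewrite rnormZr gtr0_norm//.
have -> : rho a x + rho a x = rho h1 x - 'i%C *: rho h2 x.
  change ((rho a + rho a) x = rho h1 x - 'i%C *: rho h2 x).
  by rewrite -(linD lr) e (linB lr) (linZ lr) adj_subE.
have := rnormB (rho h1 x) ('i%C *: rho h2 x); rewrite rnormZi.
have := rnorm_ge0 x; nra.
Qed.

End StarHomBounded.

(** Left multiplication by [f c] represents [B] on itself. At the vector [(f b)^†] its bound reads
    [|f b|^2 <= 4 |b| |f b|]. *)
Lemma star_endo_bounded (R : realType) (B : cstarAlgType R) (f : B -> B) b :
  star_hom f -> rnorm (f b) <= 4 * rnorm b.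
Proof.
move=> [lf mf sf].
have hom : star_hom (fun c => lmul (f c) : 'L(selfmod B)).
  split.
  - move=> k c d; apply: adjP => x.
    change (f (k *: c + d) ** x = k *: (f c ** x) + f d ** x).
    by rewrite lf amulDl amulZl.
  - move=> c d; apply: adjP => x.
    by change (f (c ** d) ** x = f c ** (f d ** x)); rewrite mf amulA.
  - by move=> c; apply: adjP => x; change (f c^† ** x = (f c)^† ** x); rewrite sf.
have := star_hom_bounded hom b ((f b)^† : selfmod B).
rewrite -[rnorm (_ : selfmod B)]/(rnorm (f b ** (f b)^†)).
rewrite -[rnorm ((f b)^† : selfmod B)]/(rnorm (f b)^†).
have := rnorm_cstar (f b)^†; rewrite astarK rnorm_star => ->.
have [->|n0] := eqVneq (f b) 0; first by rewrite rnorm0 mulr_ge0 ?rnorm_ge0.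
by rewrite expr2 ler_pM2r// rnorm_gt0.
Qed.

(** * Operators determined on total families *)

Section Combinations.
Context {R : realType} {J : Type}.

(** Keeping the list [s] apart from the family lets one list give matching combinations of [e] and
    of [f], without asking whether [e j |-> f j] is well defined. *)
Definition comb (V : lmodType R[i]) (e : J -> V) (s : seq (R[i] * J)) : V :=
  \sum_(p <- s) p.1 *: e p.2.

Definition total (V : normedModType R[i]) (e : J -> V) : Prop :=
  forall x (eps : R), 0 < eps -> exists s, rnorm (x - comb e s) < eps.

Definition subcomb (s t : seq (R[i] * J)) := s ++ [seq (- p.1, p.2) | p <- t].

Lemma combB (V : lmodType R[i]) (e : J -> V) s t :
  comb e (subcomb s t) = comb e s - comb e t.
Proof.
rewrite /comb big_cat/= big_map -sumrN; congr (_ + _).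
by apply: eq_bigr => p _ /=; rewrite scaleNr.
Qed.

Lemma comb1 (V : lmodType R[i]) (e : J -> V) j : comb e [:: (1, j)] = e j.
Proof. by rewrite /comb big_seq1 scale1r. Qed.

Lemma lin_comb (V W : lmodType R[i]) (f : V -> W) (lf : linear f) e s :
  f (comb e s) = comb (f \o e) s.
Proof.
rewrite /comb; elim: s => [|p s ih]; first by rewrite !big_nil (lin0 lf).
by rewrite !big_cons (linD lf) (linZ lf) ih.
Qed.

Lemma dense_total (V : normedModType R[i]) (S : set V) (e : J -> V) :
  dense (lspan S) -> (forall y, S y -> exists j, y = e j) -> total e.
Proof.
move=> dS hS x eps eps0; have [y [n [k [s [Ss ->]]]] hy] := dense_rnorm x dS eps0.
have [j hj] := choice (fun i => hS _ (Ss i)).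
exists [seq (k i, j i) | i <- enum 'I_n]; rewrite /comb big_map big_enum/=.
by under eq_bigr do rewrite -hj.
Qed.

Lemma total_eq0 (V W : normedModType R[i]) (f : V -> W) (C : R) (e : J -> V) :
  linear f -> (forall x, rnorm (f x) <= C * rnorm x) -> total e ->
  (forall j, f (e j) = 0) -> forall x, f x = 0.
Proof.
move=> lf bf te fe x; apply: rnorm_le0 => eps eps0.
have c0 : 0 < 1 + `|C| by rewrite ltr_pwDl.
have [|s hs] := te x (eps / (1 + `|C|)); first by rewrite divr_gt0.
have -> : f x = f (x - comb e s).
  rewrite (linB lf) (lin_comb lf) /comb big1 ?subr0// => p _ /=.
  by rewrite fe scaler0.
apply: (le_trans (bf _)); apply: (@le_trans _ _ ((1 + `|C|) * rnorm (x - comb e s))).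
  by rewrite ler_wpM2r ?rnorm_ge0// (le_trans (ler_norm C))// lerDr.
by rewrite mulrC -ler_pdivlMr// ltW.
Qed.

(** The bound on differences of combinations makes the images Cauchy and the values at [e j]
    correct. Linearity is not asserted: in [adjointable_extension] it follows from the adjoint
    relation. *)
Lemma bounded_extension (V : normedModType R[i]) (W : completeNormedModType R[i])
    (e : J -> V) (f : J -> W) (M : R) :
  total e -> 0 <= M -> (forall s, rnorm (comb f s) <= M * rnorm (comb e s)) ->
  exists g : V -> W,
    (forall x (eps : R), 0 < eps -> exists s,
       rnorm (x - comb e s) < eps /\ rnorm (g x - comb f s) < eps) /\
    forall j, g (e j) = f j.
Proof.
move=> te M0 bM.
(* Approximating [x] within [2^-1 ^+ n / (4 * (1 + M))] keeps consecutive images within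
   [2^-1 ^+ n.+1]. *)
have c0 : 0 < 4 * (1 + M) by lra.
have ex (x : V) : exists y : W, forall eps : R, 0 < eps -> exists s,
    rnorm (x - comb e s) < eps /\ rnorm (y - comb f s) < eps.
  have : forall n : nat, exists s,
      rnorm (x - comb e s) < 2^-1 ^+ n / (4 * (1 + M)).
    by move=> n; apply: te; rewrite divr_gt0// exprn_gt0.
  move=> /choice[s hs].
  have hs' n : rnorm (x - comb e (s n)) * (4 * (1 + M)) < 2^-1 ^+ n.
    by rewrite -ltr_pdivlMr.
  have [n|y hy] := @fast_cauchy_cvg _ _ (fun n => comb f (s n)).
    rewrite -combB; apply: (le_trans (bM _)); rewrite combB.
    have -> : comb e (s n) - comb e (s n.+1) =
        (x - comb e (s n.+1)) - (x - comb e (s n)).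
      by rewrite opprB [RHS]addrC addrA subrK.
    have := rnormB (x - comb e (s n.+1)) (x - comb e (s n)).
    have := hs' n; have := hs' n.+1; rewrite exprS.
    have := rnorm_ge0 (x - comb e (s n)); have := rnorm_ge0 (x - comb e (s n.+1)).
    nra.
  exists y => eps eps0; have [n] := small_pow 1 eps0; rewrite mul1r => hn.
  exists (s n); split; last by rewrite rdistC (le_lt_trans (hy n)).
  have := hs' n; have := rnorm_ge0 (x - comb e (s n)); nra.
have [g hg] := choice ex.
exists g; split=> // j; apply/eqP; rewrite -subr_eq0; apply/eqP/rnorm_le0 => eps eps0.
have [|s [h1 h2]] := hg (e j) (eps / (1 + M)); first by rewrite divr_gt0//; lra.
rewrite -(subrK (comb f s) (g (e j))) -addrA; apply: (le_trans (rnormD _ _)).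
have := bM (subcomb s [:: (1, j)]); rewrite !combB !comb1 => h3.
rewrite ltr_pdivlMr in h1; last by lra.
rewrite ltr_pdivlMr in h2; last by lra.
rewrite rdistC in h1; nra.
Qed.

End Combinations.

Section AdjointableExtension.
Context {R : realType} {B : cstarAlgType R} {E F : hilbertModType B}.

Lemma inner_combl J (e : J -> E) s z :
  inner (comb e s) z = \sum_(p <- s) Num.conj p.1 *: inner (e p.2) z.
Proof.
rewrite /comb; elim: s => [|p s ih]; first by rewrite !big_nil inner0l.
by rewrite !big_cons innerDl innerZl ih.
Qed.

Lemma inner_combr J (e : J -> E) s z :
  inner z (comb e s) = \sum_(p <- s) p.1 *: inner z (e p.2).
Proof.
rewrite /comb; elim: s => [|p s ih]; first by rewrite !big_nil inner0r.
by rewrite !big_cons innerDr innerZr ih.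
Qed.

Lemma adjointable_eq_total J (e : J -> E) (S T : 'L(E, F)) :
  total e -> (forall j, S (e j) = T (e j)) -> S = T.
Proof.
move=> te h; apply: adjP => x.
have [C C0 bS] := adj_bounded S; have [D D0 bT] := adj_bounded T.
apply/eqP; rewrite -subr_eq0; apply/eqP.
apply: (@total_eq0 _ _ _ _ (fun x => S x - T x) (C + D) _ _ _ te).
- by move=> k y z; rewrite !adjD !adjZ scalerBr opprD addrACA.
- by move=> y; rewrite (le_trans (rnormB _ _))// mulrDl lerD.
- by move=> j; rewrite h subrr.
Qed.

End AdjointableExtension.

(** The two extensions are adjoint on finite combinations by sesquilinearity, and simultaneous
    approximation passes this to all vectors. *)
Lemma adjointable_extension (R : realType) (B : cstarAlgType R)
    (E F : hilbertModType B) (J J' : Type) (e : J -> E) (f : J -> F)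
    (e' : J' -> F) (f' : J' -> E) (M : R) :
  total e -> total e' -> 0 <= M ->
  (forall s, rnorm (comb f s) <= M * rnorm (comb e s)) ->
  (forall s, rnorm (comb f' s) <= M * rnorm (comb e' s)) ->
  (forall j j', inner (f j) (e' j') = inner (e j) (f' j')) ->
  exists T : 'L(E, F),
    (forall j, T (e j) = f j) /\ (forall j', adj_adj T (e' j') = f' j').
Proof.
move=> te te' M0 bf bf' adj.
have [g [gx ge]] := bounded_extension te M0 bf.
have [g' [gx' ge']] := bounded_extension te' M0 bf'.
suff h x z : inner (g x) z = inner x (g' z).
  by exists (Adjointable h).
apply/eqP; rewrite -subr_eq0; apply/eqP/rnorm_le0 => eps eps0.
(* Replacing the four vectors by combinations produces four errors, together at most [6 * K * d];
   the summands [+ 1] absorb the approximation error of [p] and [p'], since [d <= 1]. *)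
pose K := rnorm z + (rnorm (g x) + 1) + rnorm (g' z) + (rnorm x + 1).
have K0 : 0 < 6 * K.
  rewrite /K; have := rnorm_ge0 z; have := rnorm_ge0 x.
  by have := rnorm_ge0 (g x); have := rnorm_ge0 (g' z); lra.
pose d := Num.min 1 (eps / (6 * K)).
have d0 : 0 < d by rewrite lt_min divr_gt0// ltr01.
have d1 : d <= 1 by rewrite ge_min lexx.
have dK : 6 * K * d <= eps.
  by rewrite mulrC -ler_pdivlMr// ge_min lexx orbT.
have [s [hs hs']] := gx x _ d0; have [t [ht ht']] := gx' z _ d0.
set p := comb e s in hs; set p' := comb f s in hs'.
set q := comb e' t in ht; set q' := comb f' t in ht'.
have pq : inner p' q = inner p q'.
  rewrite !inner_combl; apply: eq_bigr => i _; congr (_ *: _).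
  by rewrite !inner_combr; apply: eq_bigr => j _; rewrite adj.
have -> : inner (g x) z - inner x (g' z) =
    (inner (g x - p') z + inner p' (z - q)) -
    (inner (x - p) (g' z) + inner p (g' z - q')).
  rewrite !innerBl !innerBr addrA subrK [inner x _ - _ + _]addrA subrK pq.
  by rewrite opprB addrA subrK.
have np' : rnorm p' <= rnorm (g x) + 1.
  have := rnormB (g x) (g x - p'); rewrite opprB addrC subrK; lra.
have np : rnorm p <= rnorm x + 1.
  have := rnormB x (x - p); rewrite opprB addrC subrK; lra.
apply: (le_trans (rnormB _ _)); apply: le_trans dK.
apply: (le_trans (lerD (rnormD _ _) (rnormD _ _))).
have h1 := rnorm_inner (g x - p') z; have h2 := rnorm_inner p' (z - q).
have h3 := rnorm_inner (x - p) (g' z); have h4 := rnorm_inner p (g' z - q').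
have k1 : rnorm (g x - p') * rnorm z <= d * rnorm z.
  by rewrite ler_wpM2r ?rnorm_ge0// ltW.
have k2 : rnorm p' * rnorm (z - q) <= (rnorm (g x) + 1) * d.
  by rewrite ler_pM ?rnorm_ge0// ltW.
have k3 : rnorm (x - p) * rnorm (g' z) <= d * rnorm (g' z).
  by rewrite ler_wpM2r ?rnorm_ge0// ltW.
have k4 : rnorm p * rnorm (g' z - q') <= (rnorm x + 1) * d.
  by rewrite ler_pM ?rnorm_ge0// ltW.
rewrite /K; nra.
Qed.

(** * Conjugation by a unitary and what it preserves *)

Section StrictContinuity.
Context {R : realType} {B : cstarAlgType R} {E F : hilbertModType B}.

Lemma adj_continuous (u : 'L(E, F)) : continuous u.
Proof.
have [C C0 bu] := adj_bounded u.
move=> x P /nbhs_rnorm[eps eps0 hP]; apply/nbhs_normP.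
exists (eps / (1 + C))%:C%C => /=.
  by rewrite (@ltcR R 0) divr_gt0//; lra.
move=> y /=; rewrite rnormE ltcR ltr_pdivlMr; last by lra.
move=> hy; apply: hP; rewrite -adjB; apply: (le_lt_trans (bu _)).
by have := rnorm_ge0 (x - y); nra.
Qed.

Lemma ptws_conj (u : 'L(E, F)) (X : Type) (P : set_system X) {FP : Filter P}
    (a : X -> E -> E) (b : E -> E) :
  {ptws, a @ P --> b} ->
  {ptws, (fun (x : X) (y : F) => u (a x (adj_adj u y))) @ P -->
    (fun y : F => u (b (adj_adj u y)))}.
Proof.
move=> /pointwise_cvgP h; apply/pointwise_cvgP => y.
exact: (cvg_comp _ _ (h (adj_adj u y)) (@adj_continuous u _)).
Qed.

(** Strict convergence is pointwise convergence of [T] and of its adjoint, and conjugation acts on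
    both by [y |-> u (_ (adj_adj u y))]. *)
Lemma Ad_unitary_strict_continuous (u : 'L(E, F)) :
  continuous (Ad_unitary u : strict_op E -> strict_op F).
Proof.
suff h : continuous (@strict_embedding R B F \o (Ad_unitary u : strict_op E -> _)).
  apply/continuousP => _ [Q oQ <-]; rewrite -comp_preimage.
  by move/continuousP : h; apply.
move=> S.
have hS : strict_embedding T @[T --> (S : strict_op E)] --> strict_embedding S.
  exact: initial_continuous.
have h1 : {ptws, (adj_fun T : E -> E) @[T --> (S : strict_op E)] --> (S : E -> E)}.
  exact: (cvg_comp _ _ hS
    (@cvg_fst _ _ (nbhs (adj_fun S : {ptws E -> E}))
                  (nbhs (adj_adj S : {ptws E -> E})) _)).
have h2 : {ptws, (adj_adj T : E -> E) @[T --> (S : strict_op E)] --> adj_adj S}.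
  exact: (cvg_comp _ _ hS
    (@cvg_snd _ _ (nbhs (adj_fun S : {ptws E -> E}))
                  (nbhs (adj_adj S : {ptws E -> E})) _)).
apply: (cvg_pair (ptws_conj (u := u) h1) (ptws_conj (u := u) h2));
  exact: (@nbhs_filter {ptws F -> F}).
Qed.

End StrictContinuity.

Section Unitary.
Context {R : realType} {B : cstarAlgType R} {E F : hilbertModType B}.
Variable u : 'L(E, F).
Hypothesis uu : unitary_op u.

Lemma unitary_adjK x : adj_adj u (u x) = x.
Proof. by have [/(congr1 (fun T : 'L(E) => T x))] := uu. Qed.

Lemma unitaryK y : u (adj_adj u y) = y.
Proof. by have [_ /(congr1 (fun T : 'L(F) => T y))] := uu. Qed.

Lemma unitary_adjoint : unitary_op (adjoint u).
Proof.
split; apply: adjP => x; [exact: unitaryK|exact: unitary_adjK].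
Qed.

Lemma Ad_unitaryE (S : 'L(E)) y : Ad_unitary u S y = u (S (adj_adj u y)).
Proof. by []. Qed.

Lemma Ad_unitary_star_hom : star_hom (Ad_unitary u).
Proof.
split.
- move=> k S T; apply: adjP => y.
  change (u (k *: S (adj_adj u y) + T (adj_adj u y)) =
    k *: u (S (adj_adj u y)) + u (T (adj_adj u y))).
  by rewrite adjD adjZ.
- move=> S T; apply: adjP => y.
  change (u (S (T (adj_adj u y))) = u (S (adj_adj u (u (T (adj_adj u y)))))).
  by rewrite unitary_adjK.
- by move=> S; apply: adjP.
Qed.

End Unitary.

Section UnitaryIso.
Context {R : realType} {B : cstarAlgType R} {E F : hilbertModType B}.
Variable u : 'L(E, F).
Hypothesis uu : unitary_op u.

Lemma Ad_unitaryK : cancel (Ad_unitary u) (Ad_unitary (adjoint u)).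
Proof.
move=> S; apply: adjP => x.
change (adj_adj u (u (S (adj_adj u (u x)))) = S x).
by rewrite !(unitary_adjK uu).
Qed.

Lemma Ad_unitary_adjK : cancel (Ad_unitary (adjoint u)) (Ad_unitary u).
Proof.
move=> S; apply: adjP => x.
change (u (adj_adj u (S (u (adj_adj u x)))) = S x).
by rewrite !(unitaryK uu).
Qed.

Lemma Ad_unitary_star_iso : star_iso (Ad_unitary u).
Proof.
split; first exact: Ad_unitary_star_hom.
by exists (Ad_unitary (adjoint u)); [exact: Ad_unitaryK|exact: Ad_unitary_adjK].
Qed.

Lemma Ad_unitary_fixed_points (G : groupType) (U : G -> E -> E) (W : G -> F -> F) :
  (forall g x, u (U g x) = W g (u x)) ->
  forall S, fixed_points U S -> fixed_points W (Ad_unitary u S).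
Proof.
move=> uU S hS g y; rewrite !Ad_unitaryE -uU.
have -> : adj_adj u (W g^-1%g y) = U g^-1%g (adj_adj u y).
  by rewrite -[y in LHS](unitaryK uu) -uU (unitary_adjK uu).
by rewrite hS.
Qed.

(** Conjugating the entries of a factor [C] gives a factor of the conjugated matrix. *)
Lemma Ad_unitary_completely_positive (A : starAlgType R) (L : A -> 'L(E)) :
  completely_positive L -> completely_positive (Ad_unitary u \o L).
Proof.
have [la ma sa] := Ad_unitary_star_hom uu.
move=> [lL pL]; split=> [k a b|n M pM] /=; first by rewrite lL la.
have [C hC] := pL n M pM; exists (map_mx (Ad_unitary u) C) => i j.
have := hC i j; rewrite !mxE /= => ->.
have ls : forall s : seq 'I_n,
   Ad_unitary u (\sum_(k <- s) (C k i)^† ** C k j) =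
   \sum_(k <- s) Ad_unitary u ((C k i)^† ** C k j).
  by elim=> [|k s ih]; rewrite ?big_nil ?(lin0 la)// !big_cons (linD la) ih.
by rewrite ls; apply: eq_bigr => k _; rewrite !mxE ma sa.
Qed.

Lemma Ad_unitary_strictly_continuous_on_ball (A : cstarAlgType R)
    (H : hilbertModType A) (L : 'L(H) -> 'L(E)) :
  strictly_continuous_on_ball L ->
  strictly_continuous_on_ball (Ad_unitary u \o L).
Proof.
move=> cL; apply: within_continuous_comp cL => S _.
exact: Ad_unitary_strict_continuous.
Qed.

End UnitaryIso.

(** * Unitaries and intertwiners from total families *)

Lemma isometric_comb (R : realType) (B : cstarAlgType R) (E F : hilbertModType B)
    (J : Type) (e : J -> E) (f : J -> F) s :
  (forall i j, inner (f i) (f j) = inner (e i) (e j)) ->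
  rnorm (comb f s) = rnorm (comb e s).
Proof.
move=> h; apply/eqP; rewrite -(@eqrXn2 _ 2) ?rnorm_ge0// -!rnorm_inner_self.
rewrite !inner_combl; apply/eqP; congr rnorm; apply: eq_bigr => i _.
by rewrite !inner_combr; congr (_ *: _); apply: eq_bigr => j _; rewrite h.
Qed.

(** Equal inner products make [e j |-> f j] and [f j |-> e j] isometric on combinations and mutually
    adjoint, so the adjoint of the extension is its inverse. *)
Lemma unitary_of_isometry (R : realType) (B : cstarAlgType R)
    (E F : hilbertModType B) (J : Type) (e : J -> E) (f : J -> F) :
  total e -> total f ->
  (forall i j, inner (f i) (f j) = inner (e i) (e j)) ->
  exists2 u : 'L(E, F), unitary_op u & forall j, u (e j) = f j.
Proof.
move=> te tf h.
have [||u [ue uf]] := adjointable_extension te tf ler01 (f := f) (f' := e) _ _ h.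
- by move=> s; rewrite mul1r (isometric_comb s h).
- by move=> s; rewrite mul1r (isometric_comb s h).
exists u => //; split.
  by apply: (adjointable_eq_total te) => j; rewrite -[LHS]/(adj_adj u (u (e j))) ue uf.
by apply: (adjointable_eq_total tf) => j; rewrite -[LHS]/(u (adj_adj u (f j))) uf ue.
Qed.

(** The group acts by twisted unitaries, which need not be adjointable, so the density argument uses
    only their boundedness. *)
Lemma bounded_intertwine (R : realType) (B : cstarAlgType R)
    (E F : hilbertModType B) (J : Type) (e : J -> E) (u : 'L(E, F))
    (U : E -> E) (W : F -> F) :
  bounded_op U -> bounded_op W -> total e ->
  (forall j, u (U (e j)) = W (u (e j))) -> forall x, u (U x) = W (u x).
Proof.
have real_bound (V : normedModType R[i]) (T : V -> V) : bounded_op T ->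
    linear T /\ exists2 C : R, 0 <= C & forall x, rnorm (T x) <= C * rnorm x.
  move=> [lT [M bM]]; split => //; exists `|complex.Re M| => // x.
  have := bM x; rewrite !rnormE lecE => /andP[_ /=].
  case: M {bM} => a b /=; rewrite mulr0 subr0 => h; apply: (le_trans h).
  by rewrite ler_wpM2r ?rnorm_ge0// ler_norm.
move=> /real_bound[lU [C C0 bU]] /real_bound[lW [D D0 bW]] te h x.
have [K K0 bu] := adj_bounded u.
apply/eqP; rewrite -subr_eq0; apply/eqP.
apply: (@total_eq0 _ _ _ _ (fun x => u (U x) - W (u x)) (K * C + D * K) _ _ _ te).
- move=> k y z; rewrite adjD adjZ (linD lU) (linZ lU) adjD adjZ (linD lW) (linZ lW).
  by rewrite scalerBr opprD addrACA.
- move=> y; rewrite (le_trans (rnormB _ _))// mulrDl lerD//.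
    by rewrite (le_trans (bu _))// -mulrA ler_wpM2l.
  by rewrite (le_trans (bW _))// -mulrA ler_wpM2l.
- by move=> j; rewrite h subrr.
Qed.

(** * Extending a representation to the multiplier algebra *)

Section ApproximateUnit.
Context {R : realType} {A : cstarAlgType R}.
Context {I : Type} {le : I -> I -> Prop} {e : I -> A}.
Hypothesis au : approximate_unit le e.

Lemma approximate_unit_seq (s : seq A) (eps : R) : 0 < eps ->
  exists b : A, rnorm b <= 1 /\ forall a, a \in s -> rnorm (a - b ** a) < eps.
Proof.
have [[[i0] le_refl le_trans le_dir] e1 _ eL _] := au => eps0.
suff [i hi] : exists i, forall j, le i j -> forall a, a \in s ->
    rnorm (a - e j ** a) < eps.
  exists (e i); split; last exact: hi.
  by rewrite -lecR -rnormE; have [_] := e1 i.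
elim: s => [|a s [i hi]]; first by exists i0.
have eps0' : 0 < eps%:C%C by rewrite (@ltcR R 0).
have [j hj] := eL a _ (nbhsx_ballx a _ eps0').
have [k [ik jk]] := le_dir i j.
exists k => l kl b; rewrite inE => /orP[/eqP ->|bs].
  have := hj l (le_trans _ _ _ jk kl).
  by rewrite -ball_normE/= rnormE ltcR.
exact: hi (le_trans _ _ _ ik kl) _ bs.
Qed.

End ApproximateUnit.

Section MultiplierRepresentation.
Context {R : realType} {A B : cstarAlgType R} {F : hilbertModType B}.
Variable pi : A -> 'L(F).
Hypothesis pi_rep : nondegenerate_rep pi.
Implicit Types (S T : multiplier A).

Lemma rep_star_hom : star_hom pi. Proof. by case: pi_rep. Qed.

Lemma rep_total : total (fun p : A * F => pi p.1 p.2).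
Proof.
apply: dense_total pi_rep.2 _ => _ [a [x ->]].
by exists (a, x).
Qed.

Lemma rep_mulE a b y : pi (a ** b) y = pi a (pi b y).
Proof. by have [_ m _] := rep_star_hom; rewrite m. Qed.

Lemma rep_inner a y b z : inner (pi a y) (pi b z) = inner y (pi (a^† ** b) z).
Proof.
have [_ _ s] := rep_star_hom.
by rewrite rep_mulE adj_prop s.
Qed.

Lemma multiplier_mul S a b : S (a ** b) = (S a : A) ** b.
Proof. exact: (adj_ract S). Qed.

Lemma multiplier_adj S a b : (S a : A)^† ** b = a^† ** (adj_adj S b : A).
Proof. exact: (adj_prop S). Qed.

(** As [S (b ** a) = S b ** a], the operator [pi (S b)] sends a combination of [pi a y] to that of
    [pi (S (b ** a)) y]. Its bound [4 * C] is uniform over the unit ball, and [b] can be nearly a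
    unit for the finitely many [a] involved. *)
Lemma rep_multiplier_bounded I (le : I -> I -> Prop) (e : I -> A) S :
  approximate_unit le e -> exists2 M : R, 0 <= M &
    forall s, rnorm (comb (fun p : A * F => pi (S p.1) p.2) s) <=
              M * rnorm (comb (fun p : A * F => pi p.1 p.2) s).
Proof.
move=> au; have [C C0 bS] := adj_bounded S.
have [lp _ _] := rep_star_hom.
have bpi := star_hom_bounded rep_star_hom.
have bpiS a y : rnorm (pi (S a) y) <= 4 * C * rnorm a * rnorm y.
  apply: (le_trans (bpi _ _)); have : rnorm (S a : A) <= C * rnorm a := bS a.
  by move=> h; rewrite ler_wpM2r ?rnorm_ge0// -mulrA ler_wpM2l.
exists (4 * C) => [|s]; first by rewrite mulr_ge0.
(* [K] times the defect of [b] bounds the error, hence the tolerance [eps / (1 + K)]. *)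
pose K := \sum_(p <- s) Normc.normc p.1 * (4 * C * rnorm p.2.2).
have K0 : 0 <= K.
  by apply: sumr_ge0 => p _; rewrite !mulr_ge0 ?normc_ge0 ?rnorm_ge0.
apply/ler_addgt0Pr => eps eps0.
have [|b [b1 hb]] := approximate_unit_seq au [seq p.2.1 | p <- s]
    (eps := eps / (1 + K)).
  by rewrite divr_gt0//; lra.
set c := comb _ s; set c' := comb (fun p : A * F => pi p.1 p.2) s.
have cE : pi (S b) c' = comb (fun p : A * F => pi (S (b ** p.1)) p.2) s.
  rewrite (lin_comb (adj_linear _)); apply: eq_bigr => p _ /=.
  by rewrite multiplier_mul rep_mulE.
have -> : c = pi (S b) c' + (c - pi (S b) c') by rewrite addrC subrK.
apply: (le_trans (rnormD _ _)); apply: lerD.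
  apply: (le_trans (bpiS _ _)); rewrite ler_wpM2r ?rnorm_ge0//.
  by rewrite ler_piMr// mulr_ge0.
rewrite cE /c /comb -sumrB; apply: (@le_trans _ _ (K * (eps / (1 + K)))); last first.
  by rewrite mulrA ler_pdivrMr; nra.
rewrite /K mulr_suml.
have : forall p, p \in [seq p.2.1 | p <- s] -> rnorm (p - b ** p) <= eps / (1 + K).
  by move=> p /hb/ltW.
move: (eps / (1 + K)) => d; elim: s {K K0 hb c c' cE} => [|p s ih] hd.
  by rewrite !big_nil rnorm0.
rewrite !big_cons; apply: (le_trans (rnormD _ _)); apply: lerD; last first.
  by apply: ih => a ha; apply: hd; rewrite inE ha orbT.
rewrite -scalerBr rnormZ -mulrA ler_wpM2l ?normc_ge0//.
have -> : pi (S p.2.1) p.2.2 - pi (S (b ** p.2.1)) p.2.2 =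
    pi (S (p.2.1 - b ** p.2.1 : A)) p.2.2.
  by rewrite (adjB S) (linB lp) adj_subE.
apply: (le_trans (bpiS _ _)).
rewrite mulrAC ler_wpM2l ?mulr_ge0 ?rnorm_ge0//.
by apply: hd; rewrite mem_head.
Qed.

Lemma unital_extensionE pit : unital_extension pi pit ->
  forall S a y, pit S (pi a y) = pi (S a) y.
Proof.
move=> [[_ m _] _ ext] S a y.
by rewrite -!ext -amul_lmul m.
Qed.

(** The maps [pi a y |-> pi (S a) y] and [pi a y |-> pi (adj_adj S a) y] are adjoint because
    [(S a)^† ** b = a^† ** adj_adj S b]. *)
Lemma unital_extension_exists I (le : I -> I -> Prop) (e : I -> A) :
  approximate_unit le e -> exists pit, unital_extension pi pit.
Proof.
move=> au; have [lp _ _] := rep_star_hom.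
have ex S : exists P : 'L(F), (forall p : A * F, P (pi p.1 p.2) = pi (S p.1) p.2) /\
    (forall p : A * F, adj_adj P (pi p.1 p.2) = pi (adj_adj S p.1) p.2).
  have [M M0 bM] := rep_multiplier_bounded S au.
  have [N N0 bN] := rep_multiplier_bounded (adjoint S) au.
  apply: (adjointable_extension rep_total rep_total (M := M + N)).
  - exact: addr_ge0.
  - by move=> s; rewrite (le_trans (bM s))// ler_wpM2r ?rnorm_ge0// lerDl.
  - by move=> s; rewrite (le_trans (bN s))// ler_wpM2r ?rnorm_ge0// lerDr.
  - by move=> p q; rewrite !rep_inner multiplier_adj.
have [pit hpit] := choice ex.
have pitE S a y : pit S (pi a y) = pi (S a) y by exact: (hpit S).1 (a, y).
have pitE' S a y : adj_adj (pit S) (pi a y) = pi (adj_adj S a) y.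
  exact: (hpit S).2 (a, y).
exists pit; split.
- split.
  + move=> k S T; apply: (adjointable_eq_total rep_total) => -[a y].
    rewrite pitE -[RHS]/(k *: pit S (pi a y) + pit T (pi a y)) !pitE.
    by rewrite -[in LHS]/(k *: (S a : A) + (T a : A)) lp.
  + move=> S T; apply: (adjointable_eq_total rep_total) => -[a y].
    by rewrite pitE -[RHS]/(pit S (pit T (pi a y))) !pitE.
  + move=> S; apply: (adjointable_eq_total rep_total) => -[a y].
    by rewrite pitE -[RHS]/(adj_adj (pit S) (pi a y)) pitE'.
- by apply: (adjointable_eq_total rep_total) => -[a y]; rewrite pitE.
- move=> a; apply: (adjointable_eq_total rep_total) => -[b y].
  by rewrite pitE -rep_mulE.
Qed.

Lemma unital_extension_unique pit pit' :
  unital_extension pi pit -> unital_extension pi pit' -> pit = pit'.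
Proof.
move=> h h'; apply/funext => S; apply: (adjointable_eq_total rep_total) => -[a y].
by rewrite !unital_extensionE.
Qed.

End MultiplierRepresentation.

(** * Covariance over [B] and equivariance into multipliers *)

Section EquivariantMaps.
Context {R : realType} {G : groupType} {A B : cstarAlgType R}.
Variables (alpha : G -> A -> A) (beta : G -> B -> B).

Lemma cstar_system1 : cstar_system beta -> forall b, beta 1%g b = b.
Proof.
move=> [iso mul] b; have [_ [f fK _]] := iso 1%g.
by apply: (can_inj fK); rewrite -mul mul1g.
Qed.

Lemma cstar_systemKV : cstar_system beta -> forall g, cancel (beta g^-1%g) (beta g).
Proof. by move=> hb g b; rewrite -hb.2 mulgV cstar_system1. Qed.

Lemma cstar_systemK : cstar_system beta -> forall g, cancel (beta g) (beta g^-1%g).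
Proof. by move=> hb g b; rewrite -hb.2 mulVg cstar_system1. Qed.

Lemma cstar_hilbert_system :
  cstar_system beta -> hilbert_system beta (beta : G -> selfmod B -> selfmod B).
Proof.
move=> hb; split=> //.
- move=> g; have [hom _] := hb.1 g; split; first by case: hom.
  exists 4%:C%C => b.
  rewrite (rnormE (V := B)) (rnormE (V := B) b) -rmorphM lecR.
  exact: star_endo_bounded.
- by split=> [b|g h b]; [exact: cstar_system1|exact: hb.2].
- move=> g; exists (beta g^-1%g); split.
  + move=> x y; have [[_ m s] _] := hb.1 g.
    rewrite -[LHS]/((beta g x)^† ** (y : B)).
    rewrite -[RHS]/(beta g ((x : B)^† ** beta g^-1%g y)).
    by rewrite m s cstar_systemKV.
  + exact: cstar_systemKV.
  + exact: cstar_systemK.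
Qed.

(** The extension is [T |-> beta g \o T \o beta g^-1]. *)
Lemma conj_multiplier_extension : cstar_system beta ->
  forall g, exists2 bt : multiplier B -> multiplier B,
    multiplier_extension (beta g) bt &
    forall T b, bt T (beta g b) = beta g (T b).
Proof.
move=> hb g.
(* Stated for every [h], since conjugation for [g^-1] supplies the inverse. *)
have adjp h (T : multiplier B) (x y : selfmod B) :
    inner (beta h (T (beta h^-1%g x)) : selfmod B) y =
    inner x (beta h (adj_adj T (beta h^-1%g y)) : selfmod B).
  have [[_ m s] _] := hb.1 h.
  rewrite -[LHS]/((beta h (T (beta h^-1%g x)))^† ** (y : B)).
  rewrite -[RHS]/((x : B)^† ** beta h (adj_adj T (beta h^-1%g y))).
  rewrite -[X in _ ** X = _](cstar_systemKV hb h y) -s -m multiplier_adj m s.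
  by rewrite cstar_systemKV.
pose bt h T : multiplier B := Adjointable (adjp h T).
have btK h : cancel (bt h) (bt h^-1%g).
  move=> T; apply: adjP => x.
  rewrite -[LHS]/(beta h^-1%g (beta h (T (beta h^-1%g (beta h^-1^-1%g x))))).
  by rewrite invgK !cstar_systemK.
have btE T b : bt g T (beta g b) = beta g (T b).
  by rewrite -[LHS]/(beta g (T (beta g^-1%g (beta g b)))) cstar_systemK.
have [[l m s] _] := hb.1 g.
exists (bt g) => //; split.
- split; last first.
    exists (bt g^-1%g); first exact: btK.
    by move=> T; have := btK g^-1%g T; rewrite invgK.
  split.
  + move=> k S T; apply: adjP => x; exact: l.
  + move=> S T; apply: adjP => x.
    rewrite -[RHS]/(beta g (S (beta g^-1%g (beta g (T (beta g^-1%g x)))))).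
    by rewrite cstar_systemK.
  + by move=> T; apply: adjP.
- move=> b; apply: adjP => x.
  rewrite -[LHS]/(beta g (b ** beta g^-1%g x)) m cstar_systemKV//.
Qed.

Lemma multiplier_extensionE (b : B -> B) bt :
  multiplier_extension b bt -> forall T a, bt T (b a) = b (T a).
Proof.
move=> [[[_ m _] _] ext] T a; apply: lmul_inj.
by rewrite -amul_lmul -ext -m amul_lmul ext.
Qed.

Lemma covariant_equivariant (phi : A -> multiplier B) : cstar_system beta ->
  covariant alpha phi (beta : G -> selfmod B -> selfmod B) <->
  equivariant_map alpha beta phi.
Proof.
move=> hb; split=> [cov g|eq g a x].
  have [bt ext btE] := conj_multiplier_extension hb g.
  exists bt => // a; apply: adjP => x.
  by rewrite -[x](cstar_systemKV hb g) btE -[LHS]cov.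
have [bt ext ->] := eq g.
by rewrite (multiplier_extensionE ext).
Qed.

End EquivariantMaps.

(** * Transport along the canonical unitary *)

Theorem proposition4p10 (R : realType) (G : groupType) (A B : cstarAlgType R)
    (alpha : G -> A -> A) (beta : G -> B -> B)
    (Halpha : cstar_system alpha) (Hbeta : cstar_system beta)
    (phi : A -> multiplier B) :
  (equivariant_coupling alpha beta phi (beta : G -> selfmod B -> selfmod B)
     (alpha : G -> selfmod A -> selfmod A) <->
   nondegenerate_cp phi /\ equivariant_map alpha beta phi) /\
  (nondegenerate_cp phi -> equivariant_map alpha beta phi ->
   forall (F : hilbertModType B) (pi : A -> 'L(F)) (V : 'L(selfmod B, F))
     (W : G -> F -> F),
   equivariant_ksgns alpha beta phi (beta : G -> selfmod B -> selfmod B)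
     pi V W ->
   forall (T : hilbertModType B) (tens : selfmod A -> F -> T)
     (UW : G -> T -> T),
   relational_joint_space beta (alpha : G -> selfmod A -> selfmod A) pi W
     tens UW ->
   exists u : 'L(T, F),
     [/\ (* (1) *)
         [/\ unitary_op u,
             forall (a : A) (y : F), u (tens a y) = pi a y
           & forall g t, u (UW g t) = W g (u t)],
         (* (2) *)
         star_iso (Ad_unitary u),
         (* (3) *)
         Ad_unitary u @` fixed_points UW = fixed_points W,
         (* (4) *)
         (exists! pit : multiplier A -> 'L(F), unital_extension pi pit)
       & forall pit : multiplier A -> 'L(F), unital_extension pi pit ->
         set_bij
           [set L : multiplier A -> 'L(T) |
              relativization_map (alpha : G -> selfmod A -> selfmod A)
                tens UW L]
           [set L : multiplier A -> 'L(F) |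
              [/\ forall S, fixed_points W (L S),
                  completely_positive L,
                  strictly_continuous_on_ball L
                & forall S,
                    fixed_points (alpha : G -> selfmod A -> selfmod A) S ->
                    L S = pit S]]
           (fun L => Ad_unitary u \o L)]).
Proof.
have cov := @covariant_equivariant R G A B alpha beta phi Hbeta.
split.
  split=> [[_ _ [_ _ ncp /cov eq] _]|[ncp /cov eq]]; first by [].
  by split=> //; [split=> //|]; exact: cstar_hilbert_system.
(* The approximate unit witnessing nondegeneracy of [phi] later extends [pi] to multipliers. *)
move=> [_ [I [le [e [au _]]]]] _ F pi V W [[_ hW rep covpi] _ _ _] T tens UW.
move=> [[_ _ _ tens_inner tens_dense] hUW UWtens].
have piE := rep_star_hom rep.
have pi_total := rep_total rep.
have tens_total : total (fun p : A * F => tens p.1 p.2).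
  by apply: dense_total tens_dense _ => _ [a [y ->]]; exists (a, y).
have [|u uu ue] := unitary_of_isometry tens_total pi_total.
  by move=> p q; rewrite (rep_inner rep) tens_inner.
have utens (a : A) y : u (tens a y) = pi a y by exact: (ue (a, y)).
have uUW g t : u (UW g t) = W g (u t).
  have [_ bUW _ _] := hUW; have [_ bW _ _] := hW.
  apply: (bounded_intertwine (bUW g) (bW g) tens_total) => -[a y] /=.
  by rewrite UWtens !utens covpi.
have usW g y : adj_adj u (W g y) = UW g (adj_adj u y).
  by rewrite -[y in LHS](unitaryK uu) -uUW (unitary_adjK uu).
have usu := unitary_adjoint uu.
exists u; split.
- by split.
- exact: Ad_unitary_star_iso.
- apply/seteqP; split=> [_ [S hS <-]|S hS]; first exact: Ad_unitary_fixed_points hS.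
  exists (Ad_unitary (adjoint u) S); last exact: Ad_unitary_adjK.
  exact: (Ad_unitary_fixed_points usu) hS.
- have [pit hpit] := unital_extension_exists rep au.
  by exists pit; split=> // pit'; exact: unital_extension_unique.
- move=> pit hpit; have pitE := unital_extensionE hpit.
  split.
  + move=> L [Lfix Lcp Lsc Ltens]; split.
    * by move=> S; exact: Ad_unitary_fixed_points.
    * exact: Ad_unitary_completely_positive.
    * exact: Ad_unitary_strictly_continuous_on_ball.
    (* Under [u], the rule [tens a y |-> tens (S a) y] becomes [pi a y |-> pi (S a) y], which is
       [pit S] on a total family. *)
    * move=> S hS; apply: (adjointable_eq_total pi_total) => -[a y] /=.
      rewrite pitE -[LHS]/(u (L S (adj_adj u (pi a y)))).
      by rewrite -utens (unitary_adjK uu) Ltens// utens.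
  + move=> L L' _ _ /= h; apply/funext => S.
    by rewrite -(Ad_unitaryK uu (L S)) -(Ad_unitaryK uu (L' S));
      congr (Ad_unitary _ _); exact: (congr1 (fun f => f S) h).
  + move=> L [Lfix Lcp Lsc Lpit].
    exists (Ad_unitary (adjoint u) \o L); last first.
      by apply/funext => S /=; exact: Ad_unitary_adjK.
    split.
    * by move=> S; apply: (Ad_unitary_fixed_points usu); [exact: usW|exact: Lfix].
    * exact: (Ad_unitary_completely_positive usu).
    * exact: Ad_unitary_strictly_continuous_on_ball.
    * move=> S hS a y /=; rewrite -[LHS]/(adj_adj u (L S (u (tens a y)))).
      by rewrite Lpit// utens pitE -utens (unitary_adjK uu).
Qed.
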